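(* Let $\mathbb{K}$ be a local field, let $\psi\in L^2(\mathbb{K})$ be an admissible (mother) wavelet with admissibility constant $c_\psi=\int_{\mathbb{K}}\frac{|\hat\psi(\xi)|^2}{|\xi|}\,d\xi<\infty$, and let $f\in L^2(\mathbb{K})$. Then $$f(x)=\frac{1}{c_\psi}\int_{\mathbb{K}}\int_{\mathbb{K}} K_\psi(f)(a,b)\,\psi_{a,b}(x)\,\frac{da\,db}{|a|^2}.$$
   Context: A local field $\mathbb{K}$ is a locally compact, non-discrete, complete, totally disconnected topological field. $dx$ is a Haar measure on the additive group $\mathbb{K}^+$; the absolute value is defined by $d(\alpha x)=|\alpha|\,dx$ for $\alpha\ne0$, and $|0|=0$. Put $\mathfrak{D}=\{x\in\mathbb{K}:|x|\le 1\}$ and $\mathfrak{P}=\{x\in\mathbb{K}:|x|<1\}$. Fix a continuous unitary character $\chi$ of $\mathbb{K}^+$ that is trivial on $\mathfrak{D}$ but nontrivial on $\mathfrak{P}^{-1}$, and write $\chi_y(x)=\chi(xy)$. The Fourier transform is $\hat f(\xi)=\int_{\mathbb{K}} f(x)\overline{\chi_\xi(x)}\,dx$ for $f\in L^1(\mathbb{K})$, extended to $L^2(\mathbb{K})$; the Haar measure is such that Fourier inversion and the Parseval formula $\|\hat f\|_{L^2(\mathbb{K})}=\|f\|_{L^2(\mathbb{K})}$ hold. Functions are complex valued and $(f,g)_{L^2(\mathbb{K})}=\int_{\mathbb{K}} f\overline{g}\,dx$. A function $\psi\in L^2(\mathbb{K})$ is an admissible wavelet (mother wavelet) if $c_\psi=\int_{\mathbb{K}}\frac{|\hat\psi(\xi)|^2}{|\xi|}\,d\xi<\infty$.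 For $a,b\in\mathbb{K}$, $a\neq0$, put $\psi_{a,b}(x)=|a|^{-1/2}\psi\left(\frac{x-b}{a}\right)$. The continuous wavelet transform of $f\in L^2(\mathbb{K})$ with respect to $\psi$ is $K_\psi(f)(a,b)=(f,\psi_{a,b})_{L^2(\mathbb{K})}=\int_{\mathbb{K}} f(x)\,|a|^{-1/2}\,\overline{\psi\left(\frac{x-b}{a}\right)}\,dx$. *)

(* Defs.v *)
From HB Require Import structures.
From mathcomp Require Import all_boot all_order all_algebra.
From mathcomp Require Import complex.
From mathcomp Require Import all_classical all_reals all_analysis.

Set Implicit Arguments.
Unset Strict Implicit.
Unset Printing Implicit Defensive.

Import Order.TTheory GRing.Theory Num.Theory.
Import numFieldNormedType.Exports.
Import ComplexField.Normc.

Local Open Scope classical_set_scope.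
Local Open Scope ring_scope.
Local Open Scope complex_scope.

(* Uniform continuity of addition and opposite (UniformZmodule) makes the
   uniformity the one of the topological group (K, +), so that completeness is
   that of K as a topological group. The library class Complete is not used
   because its Pointed ancestor cannot be joined with an algebraic class. *)
HB.mixin Record UniformField_isLocalField K
    & GRing.Field K & UniformZmodule K := {
  local_mul_continuous : continuous (fun z : K * K => z.1 * z.2) ;
  local_inv_continuous :
    forall x : K, x != 0 -> {for x, continuous (fun y : K => y^-1)} ;
  local_locally_compact : locally_compact [set: K] ;
  local_nondiscrete : ~ (forall A : set K, open A) ;
  local_complete : forall F : set_system K, ProperFilter F -> cauchy F ->
    exists x : K, F --> x ;
  local_totally_disconnected : totally_disconnected [set: K] }.

#[short(type="localFieldType")]
HB.structure Definition LocalField :=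
  {K of GRing.Field K & UniformZmodule K & UniformField_isLocalField K}.

(* measurableType requires a pointed type; the point is 0. *)
Definition pointed_field (K : localFieldType) : Type := K.

HB.instance Definition _ (K : localFieldType) :=
  Choice.on (pointed_field K).
HB.instance Definition _ (K : localFieldType) :=
  isPointed.Build (pointed_field K) (0 : K).

Definition borel (K : localFieldType) :=
  @g_sigma_algebraType (pointed_field K) (@open K).

Section ComplexFunctions.
Context {d} {T : measurableType d} {R : realType}.
Variable mu : {measure set T -> \bar R}.
Implicit Types f g : T -> R[i].

Definition cmeasurable f :=
  measurable_fun setT (fun x => complex.Re (f x)) /\
  measurable_fun setT (fun x => complex.Im (f x)).

Definition cintegrable (D : set T) f :=
  mu.-integrable D (fun x => (complex.Re (f x))%:E) /\
  mu.-integrable D (fun x => (complex.Im (f x))%:E).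

Definition cintegral (D : set T) f : R[i] :=
  Rintegral mu D (fun x => complex.Re (f x)) +i* Rintegral mu D (fun x => complex.Im (f x)).

Definition cLnorm (p : \bar R) f : \bar R :=
  Lnorm mu p (fun x => (normc (f x))%:E).

Definition cLp (p : \bar R) f := cmeasurable f /\ (cLnorm p f < +oo)%E.

Definition cdot f g : R[i] := cintegral setT (fun x => f x * (g x)^*).

End ComplexFunctions.

Section HaarMeasure.
Context {R : realType} {K : localFieldType}.
Variable mu : {measure set (borel K) -> \bar R}.

Definition is_haar :=
  [/\ mu setT != 0%E,
      forall (x : K) (A : set K), measurable (A : set (borel K)) ->
        mu [set x + y | y in A] = mu A,
      forall C : set K, compact C -> (mu C < +oo)%E,
      forall A : set K, measurable (A : set (borel K)) ->
        mu A = ereal_inf [set mu U | U in [set U : set K | open U /\ A `<=` U]]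
    & forall U : set K, open U ->
        mu U =
        ereal_sup [set mu C | C in [set C : set K | compact C /\ C `<=` U]]].

(* d(a x) = |a| dx *)
Definition is_haar_modulus (abs : K -> R) :=
  abs 0 = 0 /\
  forall (a : K) (A : set K), a != 0 -> measurable (A : set (borel K)) ->
    mu [set a * x | x in A] = ((abs a)%:E * mu A)%E.

End HaarMeasure.

Section Character.
Context {R : realType} {K : localFieldType}.
Variables (abs : K -> R) (chi : K -> R[i]).

Definition integer_ring : set K := [set x | abs x <= 1].
Definition maximal_ideal : set K := [set x | abs x < 1].
(* the fractional ideal inverse to the maximal ideal *)
Definition inverse_maximal_ideal : set K :=
  [set x | forall y, maximal_ideal y -> integer_ring (x * y)].

Definition unitary_character :=
  [/\ continuous (chi : K -> R[i]^o),
      forall x y, chi (x + y) = chi x * chi y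
    & forall x, `|chi x| = 1].

Definition basic_character :=
  [/\ unitary_character,
      forall x, integer_ring x -> chi x = 1
    & exists2 x, inverse_maximal_ideal x & chi x != 1].

End Character.

Section FourierTransform.
Context {R : realType} {K : localFieldType}.
Variables (mu : {measure set (borel K) -> \bar R}) (chi : K -> R[i]).
Implicit Types f g : K -> R[i].

Definition twist_char (y x : K) : R[i] := chi (x * y).

Definition fourier f (xi : K) : R[i] :=
  cintegral mu setT (fun x : borel K => f x * (twist_char xi x)^*).

(* g is (a version of) the Fourier transform of f in L^2, i.e. the value at f
   of the extension by continuity of the transform on L^1 `&` L^2 *)
Definition is_fourierL2 f g :=
  [/\ cLp mu 2%:E f, cLp mu 2%:E g
    & exists u : nat -> K -> R[i],
      [/\ forall n, cLp mu 1%:E (u n) /\ cLp mu 2%:E (u n),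
          (fun n => cLnorm mu 2%:E (fun x => u n x - f x)) @ \oo --> 0%E
        & (fun n => cLnorm mu 2%:E (fun x => fourier (u n) x - g x)) @ \oo
            --> 0%E]].

Definition fourier_inversion :=
  forall f, cLp mu 1%:E f -> cLp mu 1%:E (fourier f) ->
    {ae mu, forall x : borel K,
      f x = cintegral mu setT
              (fun xi : borel K => fourier f xi * twist_char xi x)}.

(* Stated on L^1 `&` L^2; by density it passes to the extension to L^2. *)
Definition parseval :=
  forall f, cLp mu 1%:E f -> cLp mu 2%:E f ->
    cLp mu 2%:E (fourier f) /\ cLnorm mu 2%:E (fourier f) = cLnorm mu 2%:E f.

End FourierTransform.

Section Wavelet.
Context {R : realType} {K : localFieldType}.
Variables (mu : {measure set (borel K) -> \bar R}) (abs : K -> R).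
Implicit Types f psi psihat : K -> R[i].

(* Only a set of measure zero is concerned by the value 0^-1 = 0 at xi = 0;
   the same holds for a = 0 in the functions below. *)
Definition admissibility_constant psihat : \bar R :=
  (\int[mu]_(xi in [set: borel K]) (normc (psihat xi) ^+ 2 / abs xi)%:E)%E.

Definition wavelet psi (a b x : K) : R[i] :=
  ((Num.sqrt (abs a))^-1)%:C * psi ((x - b) / a).

Definition wavelet_transform psi f (a b : K) : R[i] :=
  cdot mu f (wavelet psi a b).

Definition reconstruction_integrand psi f (x : K) (z : K * K) : R[i] :=
  wavelet_transform psi f z.1 z.2 * wavelet psi z.1 z.2 x *
  ((abs z.1 ^+ 2)^-1)%:C.

(* its inner product with g in the variable x *)
Definition weak_reconstruction_integrand psi f g (z : K * K) : R[i] :=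
  wavelet_transform psi f z.1 z.2 * cdot mu (wavelet psi z.1 z.2) g *
  ((abs z.1 ^+ 2)^-1)%:C.

Definition scale_box (n : nat) : set (K * K) :=
  [set z | [/\ n.+1%:R^-1 <= abs z.1, abs z.1 <= n.+1%:R
             & abs z.2 <= n.+1%:R]].

End Wavelet.

(* Main.v *)
Require Import Defs.
From HB Require Import structures.
From mathcomp Require Import all_boot all_order all_algebra.
From mathcomp Require Import complex.
From mathcomp Require Import all_classical all_reals all_analysis.
From mathcomp Require Import measurable_realfun lra ring.

Set Implicit Arguments.
Unset Strict Implicit.
Unset Printing Implicit Defensive.

Import Order.TTheory GRing.Theory Num.Theory.
Import numFieldNormedType.Exports.
Import ComplexField.Normc.

Local Open Scope classical_set_scope.
(* [ring_scope] is opened last, so that [z^*] always denotes [Num.conj z]. *)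
Local Open Scope complex_scope.
Local Open Scope ring_scope.

(* With h_(a,b) = psi_(a,b) / |a| and G f (a,b) = (f, h_(a,b)), all three forms of
   the inversion formula express that G is sqrt(c_psi) times an isometry of
   L^2(K) into L^2(K x K).  For f in L^1 and L^2 and fixed a <> 0, the function
   b |-> K_psi f (a,b) is, up to conjugation, the Fourier transform of
   |a|^(1/2) conj(fhat) psihat(a .); Parseval in b, Tonelli and the invariance of
   da/|a| give the isometry, and Fatou and density extend it to L^2.
   Polarization gives the weak formula, and duality bounds the L^2 error of the
   truncated integral by the norm of G f outside the box.  The almost everywhere
   formula follows by Fatou.

   Joint measurability on K x K needs K to be second countable.  The modulus
   tends to 0 at 0 by outer regularity, so some p in a compact neighbourhood V of
   0 satisfies p V <= V and |p| < 1; then p^n tends to 0, the closed balls lie in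
   the compact sets p^-n V, and translates of the p^n V form a countable basis. *)

(** * Square-integrable complex functions *)

(** Three difficulties shape the argument. The wavelet is only square integrable, so its Fourier
    transform is a limit and not an integral: the Fourier formula for K_psi is computed for
    integrable approximants of psi and passes to the limit because u |-> u_(a,b) and the
    corresponding map on transforms preserve the norm. Parseval in b needs the spectrum at scale a
    to be square integrable, which is not given for each a; finiteness of the weighted double
    integral of the squared spectra gives it for almost every a. Finally, nothing ensures that the
    reconstruction integral converges absolutely at a given x. It is therefore cut to boxes bounded
    away from a = 0, on which the kernel is square integrable both in (a,b) at fixed x and jointly
    in (a,b,x). The exceptional values a = 0 and xi = 0 are settled by the convention 0^-1 = 0 or
    because a point is null. *)

Section ComplexModulus.
Context {R : realType}.
Implicit Types (x y z : R[i]).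

Lemma normc_ge0 z : 0 <= normc z.
Proof. by case: z => a b; exact: sqrtr_ge0. Qed.

Lemma sqr_normcE z : normc z ^+ 2 = complex.Re z ^+ 2 + complex.Im z ^+ 2.
Proof. by case: z => a b /=; rewrite sqr_sqrtr// addr_ge0 ?sqr_ge0. Qed.

Lemma normc_conj z : normc z^* = normc z.
Proof. by case: z => a b /=; rewrite sqrrN. Qed.

Lemma normc_real (r : R) : normc r%:C = `|r|.
Proof. by rewrite /= expr0n addr0 sqrtr_sqr. Qed.

Lemma norm_Re_le z : `|complex.Re z| <= normc z.
Proof.
by rewrite -(ler_pXn2r (ltn0Sn 1)) ?nnegrE ?normc_ge0// real_normK ?num_real//
  sqr_normcE lerDl sqr_ge0.
Qed.

Lemma norm_Im_le z : `|complex.Im z| <= normc z.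
Proof.
by rewrite -(ler_pXn2r (ltn0Sn 1)) ?nnegrE ?normc_ge0// real_normK ?num_real//
  sqr_normcE lerDr sqr_ge0.
Qed.

Lemma normc_le_ReIm z : normc z <= `|complex.Re z| + `|complex.Im z|.
Proof.
rewrite -(ler_pXn2r (ltn0Sn 1)) ?nnegrE ?normc_ge0 ?addr_ge0//.
rewrite sqr_normcE sqrrD !real_normK ?num_real// -addrA lerD2l lerDr.
by rewrite mulrn_wge0 ?mulr_ge0.
Qed.

Lemma sqr_normcD_le x y :
  normc (x + y) ^+ 2 <= 2 * normc x ^+ 2 + 2 * normc y ^+ 2.
Proof.
rewrite !sqr_normcE; case: x => a b; case: y => c d /=.
by have := sqr_ge0 (a - c); have := sqr_ge0 (b - d); nra.
Qed.

Lemma mulc_conj z : z * z^* = (normc z ^+ 2)%:C.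
Proof.
rewrite sqr_normcE; case: z => a b; apply/eqP; rewrite eq_complex /=.
by apply/andP; split; apply/eqP; ring.
Qed.

Lemma normcM_le x y : normc (x * y) <= normc x ^+ 2 + normc y ^+ 2.
Proof.
have := normc_ge0 x; have := normc_ge0 y; rewrite normcM.
by move: (normc x) (normc y) => a b a0 b0; have := sqr_ge0 (a - b); nra.
Qed.

Lemma normc_eq0 z : (normc z == 0) = (z == 0).
Proof. by apply/eqP/eqP => [/eq0_normc//|->]; rewrite normc0. Qed.

Lemma complex_ReIm z : z = complex.Re z +i* complex.Im z.
Proof. by case: z. Qed.

Lemma ReM x y : complex.Re (x * y) =
  complex.Re x * complex.Re y - complex.Im x * complex.Im y.
Proof. by case: x; case: y. Qed.

Lemma ImM x y : complex.Im (x * y) =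
  complex.Re x * complex.Im y + complex.Im x * complex.Re y.
Proof. by case: x => a b; case: y => c d /=. Qed.

Lemma ReD x y : complex.Re (x + y) = complex.Re x + complex.Re y.
Proof. by case: x; case: y. Qed.

Lemma ImD x y : complex.Im (x + y) = complex.Im x + complex.Im y.
Proof. by case: x => a b; case: y. Qed.

Lemma ReJ z : complex.Re z^* = complex.Re z.
Proof. by case: z. Qed.

Lemma ImJ z : complex.Im z^* = - complex.Im z.
Proof. by case: z. Qed.

Lemma cconjD x y : (x + y)^* = x^* + y^*.
Proof. exact: rmorphD. Qed.

Lemma cconjB x y : (x - y)^* = x^* - y^*.
Proof. exact: rmorphB. Qed.

Lemma cconjM x y : (x * y)^* = x^* * y^*.
Proof. exact: rmorphM. Qed.

Lemma cconjK z : z^*^* = z.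
Proof. exact: conjCK. Qed.

Lemma cconj_real (r : R) : (r%:C)^* = r%:C.
Proof. exact: conjc_real. Qed.

Lemma ReN z : complex.Re (- z) = - complex.Re z.
Proof. by case: z. Qed.

Lemma ImN z : complex.Im (- z) = - complex.Im z.
Proof. by case: z. Qed.

End ComplexModulus.

(** * Measurability of complex functions *)

Section ComplexMeasurable.
Context {d} {T : measurableType d} {R : realType}.
Implicit Types (f g : T -> R[i]) (r : T -> R).

Lemma cmeasurable_cst (z : R[i]) : cmeasurable (fun _ : T => z).
Proof. by split; exact: measurable_cst. Qed.

Lemma cmeasurable_real r : measurable_fun setT r ->
  cmeasurable (fun x => (r x)%:C).
Proof. by move=> mr; split; [exact: mr|exact: measurable_cst]. Qed.

Lemma cmeasurableD f g : cmeasurable f -> cmeasurable g ->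
  cmeasurable (fun x => f x + g x).
Proof.
move=> [fR fI] [gR gI]; split.
  by under eq_fun do rewrite ReD; exact: measurable_funD.
by under eq_fun do rewrite ImD; exact: measurable_funD.
Qed.

Lemma cmeasurableM f g : cmeasurable f -> cmeasurable g ->
  cmeasurable (fun x => f x * g x).
Proof.
move=> [fR fI] [gR gI]; split.
  under eq_fun do rewrite ReM.
  by apply: measurable_funB; exact: measurable_funM.
under eq_fun do rewrite ImM.
by apply: measurable_funD; exact: measurable_funM.
Qed.

Lemma cmeasurableN f : cmeasurable f -> cmeasurable (fun x => - f x).
Proof.
move=> [fR fI]; split.
  by under eq_fun do rewrite ReN; exact: measurableT_comp.
by under eq_fun do rewrite ImN; exact: measurableT_comp.
Qed.

Lemma cmeasurableB f g : cmeasurable f -> cmeasurable g ->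
  cmeasurable (fun x => f x - g x).
Proof. by move=> mf mg; apply: cmeasurableD => //; exact: cmeasurableN. Qed.

Lemma cmeasurable_conj f : cmeasurable f -> cmeasurable (fun x => (f x)^*).
Proof.
move=> [fR fI]; split; first by under eq_fun do rewrite ReJ.
by under eq_fun do rewrite ImJ; exact: measurableT_comp.
Qed.

Lemma measurable_normc f : cmeasurable f ->
  measurable_fun setT (fun x => normc (f x)).
Proof.
move=> [fR fI].
rewrite (_ : (fun x => _) = (fun x => @Num.sqrt R
    (complex.Re (f x) ^+ 2 + complex.Im (f x) ^+ 2))); last first.
  by apply/funext => x; case: (f x).
apply: (measurableT_comp
    (continuous_measurable_fun (@sqrt_continuous R))) => //.
by apply: measurable_funD; exact: measurable_funX.
Qed.

Lemma measurable_sqr_normc f : cmeasurable f ->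
  measurable_fun setT (fun x => (normc (f x) ^+ 2)%:E).
Proof.
by move=> mf; apply/measurable_EFinP/measurable_funX/measurable_normc.
Qed.

Lemma measurable_normcE f : cmeasurable f ->
  measurable_fun setT (fun x => (normc (f x))%:E).
Proof. by move=> mf; apply/measurable_EFinP/measurable_normc. Qed.

End ComplexMeasurable.

Lemma cmeasurable_comp {d1 d2} {T1 : measurableType d1} {T2 : measurableType d2}
    {R : realType} (f : T2 -> R[i]) (phi : T1 -> T2) :
  measurable_fun setT phi -> cmeasurable f -> cmeasurable (fun x => f (phi x)).
Proof.
by move=> mphi [fR fI]; split; [exact: (measurableT_comp fR)|exact: (measurableT_comp fI)].
Qed.

Arguments cintegral : simpl never.
Arguments cdot : simpl never.

(** * Integrals of complex functions *)

Section ComplexIntegral.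
Context {d} {T : measurableType d} {R : realType}.
Variable mu : {measure set T -> \bar R}.
Implicit Types (f g : T -> R[i]) (D : set T).

(** The modulus dominates the real and imaginary parts and is at most the sum of their absolute
    values, so later estimates can work with [normc] alone. *)
Lemma cintegrableP f : cintegrable mu setT f <->
  cmeasurable f /\ (\int[mu]_x (normc (f x))%:E < +oo)%E.
Proof.
split=> [[fR fI]|[mf foo]].
  have mf : cmeasurable f.
    by split; apply/measurable_EFinP; [exact: measurable_int fR|exact: measurable_int fI].
  split => //; have /integrableP[_] := integrableD measurableT
    (integrable_abse fR) (integrable_abse fI).
  apply: le_lt_trans; apply: ge0_le_integral => //.
  - by move=> x _; rewrite lee_fin normc_ge0.
  - exact: measurable_normcE.
  - apply: measurableT_comp => //; apply: emeasurable_funD; apply: measurableT_comp => //.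
    + by case: mf => mf _; exact/measurable_EFinP.
    + by case: mf => _ mf; exact/measurable_EFinP.
  - move=> x _ /=; rewrite lee_fin ger0_norm ?addr_ge0//.
    exact: normc_le_ReIm.
have fi : mu.-integrable setT (fun x => (normc (f x))%:E).
  apply/integrableP; split; first exact: measurable_normcE.
  by under eq_integral => x _ do rewrite gee0_abs ?lee_fin ?normc_ge0//.
split; apply: le_integrable fi => //.
- by case: mf => mf _; exact/measurable_EFinP.
- by move=> x _ /=; rewrite lee_fin (le_trans (norm_Re_le _))// ler_norm.
- by case: mf => _ mf; exact/measurable_EFinP.
- by move=> x _ /=; rewrite lee_fin (le_trans (norm_Im_le _))// ler_norm.
Qed.

Lemma cintegrable_meas f : cintegrable mu setT f -> cmeasurable f.
Proof. by move=> /cintegrableP[]. Qed.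

Lemma cintegrable_le f (g : T -> \bar R) : cmeasurable f ->
  measurable_fun setT g ->
  (forall x, (normc (f x))%:E <= g x)%E -> (\int[mu]_x g x < +oo)%E ->
  cintegrable mu setT f.
Proof.
move=> mf mg fg goo; apply/cintegrableP; split=> //.
apply: le_lt_trans goo; apply: ge0_le_integral => //.
- by move=> x _; rewrite lee_fin normc_ge0.
- exact: measurable_normcE.
Qed.

Lemma cintegrableD f g : cintegrable mu setT f -> cintegrable mu setT g ->
  cintegrable mu setT (fun x => f x + g x).
Proof.
move=> [fR fI] [gR gI]; split.
  under eq_fun do rewrite ReD EFinD; exact: integrableD.
under eq_fun do rewrite ImD EFinD; exact: integrableD.
Qed.

Lemma cintegralD f g : cintegrable mu setT f -> cintegrable mu setT g ->
  cintegral mu setT (fun x => f x + g x) =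
  cintegral mu setT f + cintegral mu setT g.
Proof.
move=> [fR fI] [gR gI]; rewrite /cintegral.
under eq_Rintegral do rewrite ReD.
under [in X in _ +i* X]eq_Rintegral do rewrite ImD.
by rewrite !RintegralD.
Qed.

Lemma cintegrableZ (c : R[i]) f : cintegrable mu setT f ->
  cintegrable mu setT (fun x => c * f x).
Proof.
move=> [fR fI]; split.
  under eq_fun do rewrite ReM EFinB !EFinM.
  by apply: integrableB => //; exact: integrableZl.
under eq_fun do rewrite ImM EFinD !EFinM.
by apply: integrableD => //; exact: integrableZl.
Qed.

Lemma cintegralZ (c : R[i]) f : cintegrable mu setT f ->
  cintegral mu setT (fun x => c * f x) = c * cintegral mu setT f.
Proof.
move=> [fR fI]; rewrite /cintegral.
under eq_Rintegral do rewrite ReM.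
under [in X in _ +i* X]eq_Rintegral do rewrite ImM.
have iZ (k : R) (h : T -> R) : mu.-integrable setT (EFin \o h) ->
    mu.-integrable setT (EFin \o (fun x => k * h x)).
  by move=> ih; rewrite /comp; under eq_fun do rewrite EFinM; exact: integrableZl.
rewrite RintegralB//; [|exact: iZ|exact: iZ].
rewrite RintegralD//; [|exact: iZ|exact: iZ].
by rewrite !RintegralZl//; case: c => a b.
Qed.

Lemma cintegrable_conj f : cintegrable mu setT f ->
  cintegrable mu setT (fun x => (f x)^*).
Proof.
move=> [fR fI]; split; first by under eq_fun do rewrite ReJ.
by under eq_fun do rewrite ImJ EFinN; exact: integrableN.
Qed.

Lemma cintegral_conj f : cintegrable mu setT f ->
  cintegral mu setT (fun x => (f x)^*) = (cintegral mu setT f)^*.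
Proof.
move=> [fR fI]; rewrite /cintegral.
under eq_Rintegral do rewrite ReJ.
under [in X in _ +i* X]eq_Rintegral do rewrite ImJ -mulN1r.
by rewrite RintegralZl// mulN1r.
Qed.

Lemma eq_cintegral D f g : {in D, f =1 g} ->
  cintegral mu D f = cintegral mu D g.
Proof.
by move=> fg; rewrite /cintegral; congr (_ +i* _);
  apply: eq_Rintegral => x xD; rewrite fg.
Qed.

Lemma cintegral0 D : cintegral mu D (fun=> 0) = 0.
Proof. by rewrite /cintegral /Rintegral !integral0. Qed.

(* Rotating by the unit complex number [w] makes the integral real. *)
Lemma normc_cintegral_le f : cintegrable mu setT f ->
  ((normc (cintegral mu setT f))%:E <= \int[mu]_x (normc (f x))%:E)%E.
Proof.
move=> fi; set I := cintegral _ _ _.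
have [I0|I0] := eqVneq I 0.
  by rewrite I0 normc0 integral_ge0// => x _; rewrite lee_fin normc_ge0.
have nI0 : normc I != 0 by rewrite normc_eq0.
pose w := I^* * ((normc I)^-1)%:C.
have nw : normc w = 1.
  by rewrite normcM normc_conj normc_real ger0_norm ?invr_ge0 ?normc_ge0// mulfV.
have wI : w * I = (normc I)%:C.
  rewrite /w mulrAC (mulrC _ I) mulc_conj -rmorphM/=.
  by rewrite expr2 -mulrA mulfV// mulr1.
have [wR _] := cintegrableZ w fi.
rewrite (_ : normc I = complex.Re (cintegral mu setT (fun x => w * f x))); last first.
  by rewrite cintegralZ// -/I wI.
rewrite /cintegral /= /Rintegral fineK ?(integrable_fin_num _ wR)//.
have mf := cintegrable_meas fi.
have mwf : measurable_fun setT (fun x => (complex.Re (w * f x))%:E).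
  exact: measurable_int wR.
apply: (@le_trans _ _ (\int[mu]_x `|(complex.Re (w * f x))%:E|)%E).
  by apply: le_trans (le_abse_integral _ _ _) => //; exact: lee_abs.
apply: ge0_le_integral => //.
- exact: measurableT_comp.
- exact: measurable_normcE.
- move=> x _ /=; rewrite lee_fin (le_trans (norm_Re_le _))//.
  by rewrite normcM nw mul1r.
Qed.

Lemma cintegrable_mkcond D f : measurable D ->
  cintegrable mu D f <-> cintegrable mu setT (fun x => (\1_D x)%:C * f x).
Proof.
move=> mD; rewrite /cintegrable !(propext (integrable_mkcond _ mD)).
rewrite [X in mu.-integrable setT X /\ _](_ : _ =
    (fun x => (complex.Re ((\1_D x)%:C * f x))%:E)); last first.
  apply/funext => x; rewrite patchE indicE; case: (x \in D) => /=.
    by rewrite ReM mul0r mul1r subr0.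
  by rewrite ReM !mul0r subr0.
rewrite [X in _ /\ mu.-integrable setT X <-> _](_ : _ =
    (fun x => (complex.Im ((\1_D x)%:C * f x))%:E))//.
apply/funext => x; rewrite patchE indicE; case: (x \in D) => /=.
  by rewrite ImM mul0r mul1r addr0.
by rewrite ImM !mul0r addr0.
Qed.

Lemma cintegral_mkcond D f :
  cintegral mu D f = cintegral mu setT (fun x => (\1_D x)%:C * f x).
Proof.
rewrite /cintegral !(Rintegral_mkcond mu D); congr (_ +i* _).
  apply: eq_Rintegral => x _; rewrite patchE indicE; case: (x \in D) => /=.
    by rewrite ReM mul0r mul1r subr0.
  by rewrite ReM !mul0r subr0.
apply: eq_Rintegral => x _; rewrite patchE indicE; case: (x \in D) => /=.
  by rewrite ImM mul0r mul1r addr0.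
by rewrite ImM !mul0r addr0.
Qed.

End ComplexIntegral.

(** * The squared L^2 norm and the inner product *)

Section SquareNorm.
Context {d} {T : measurableType d} {R : realType}.
Variable mu : {measure set T -> \bar R}.
Implicit Types (f g : T -> R[i]).

(** Kept extended real and without a root, so that Tonelli, Fatou and monotonicity of the integral
    apply to it directly. *)
Definition sqnorm f : \bar R := (\int[mu]_x (normc (f x) ^+ 2)%:E)%E.

Definition L2 f := cmeasurable f /\ (sqnorm f < +oo)%E.

Lemma sqnorm_ge0 f : (0 <= sqnorm f)%E.
Proof. by apply: integral_ge0 => x _; rewrite lee_fin sqr_ge0. Qed.

Lemma L2_meas f : L2 f -> cmeasurable f. Proof. by case. Qed.

Lemma L2_fin f : L2 f -> (fine (sqnorm f))%:E = sqnorm f.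
Proof. by move=> [_ foo]; rewrite fineK// ge0_fin_numE ?sqnorm_ge0. Qed.

Lemma eq_sqnorm f g : (forall x, normc (f x) = normc (g x)) ->
  sqnorm f = sqnorm g.
Proof. by move=> fg; apply: eq_integral => x _; rewrite fg. Qed.

Lemma le_sqnorm f g : cmeasurable f -> cmeasurable g ->
  (forall x, normc (f x) <= normc (g x)) -> (sqnorm f <= sqnorm g)%E.
Proof.
move=> mf mg fg; apply: ge0_le_integral => //.
- by move=> x _; rewrite lee_fin sqr_ge0.
- exact: measurable_sqr_normc.
- exact: measurable_sqr_normc.
- by move=> x _; rewrite lee_fin ler_pXn2r ?nnegrE ?normc_ge0.
Qed.

Lemma L2_le f g : cmeasurable f -> L2 g ->
  (forall x, normc (f x) <= normc (g x)) -> L2 f.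
Proof.
move=> mf [mg goo] fg; split=> //; apply: le_lt_trans goo; exact: le_sqnorm.
Qed.

Lemma cLnorm2E f : cLnorm mu 2%:E f = (sqnorm f `^ 2^-1)%E.
Proof.
rewrite /cLnorm unlock; congr (_ `^ _)%E; apply: eq_integral => x _.
by rewrite /= powR_mulrn// ger0_norm ?normc_ge0.
Qed.

Lemma cLp2P f : cLp mu 2%:E f <-> L2 f.
Proof.
rewrite /cLp cLnorm2E; split=> -[mf foo]; split=> //.
  by apply: lty_poweRy foo; rewrite invr_eq0.
exact: poweR_lty.
Qed.

Lemma cLp1P f : cLp mu 1%:E f <-> cintegrable mu setT f.
Proof.
rewrite cintegrableP /cLp /cLnorm Lnorm1.
by under eq_integral do rewrite gee0_abs ?lee_fin ?normc_ge0//.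
Qed.

Lemma sqnorm_cLnorm2 f g : cLnorm mu 2%:E f = cLnorm mu 2%:E g ->
  sqnorm f = sqnorm g.
Proof.
rewrite !cLnorm2E !poweR12_sqrt ?sqnorm_ge0// => fg.
by rewrite -(sqr_sqrte (sqnorm_ge0 f)) fg sqr_sqrte// sqnorm_ge0.
Qed.

(** Replaces convergence of norms by an inequality on squared norms, where no root appears and
    finiteness is implicit. *)
Lemma cLnorm2_cvg0 (u : nat -> T -> R[i]) :
  (fun n => cLnorm mu 2%:E (u n)) @ \oo --> 0%E <->
  (forall e : R, 0 < e -> \forall n \near \oo, (sqnorm (u n) < e%:E)%E).
Proof.
split=> [/fine_cvgP[ufin /cvgr0Pnorm_lt u0] e e0|u0].
  have se0 : 0 < Num.sqrt e by rewrite sqrtr_gt0.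
  near=> n.
  have : `|fine (cLnorm mu 2%:E (u n))| < Num.sqrt e by near: n; exact: u0.
  have : cLnorm mu 2%:E (u n) \is a fin_num by near: n.
  rewrite cLnorm2E poweR12_sqrt ?sqnorm_ge0//.
  have := sqnorm_ge0 (u n); case: (sqnorm (u n)) => [r| |]//=.
  rewrite lee_fin => r0 _; rewrite ger0_norm ?sqrtr_ge0// lte_fin.
  by rewrite ltr_sqrt.
have key e : 0 < e -> \forall n \near \oo,
    exists2 r : R, cLnorm mu 2%:E (u n) = r%:E & `|r| < e.
  move=> e0; near=> n.
  have : (sqnorm (u n) < (e ^+ 2)%:E)%E by near: n; apply: u0; rewrite exprn_gt0.
  rewrite cLnorm2E poweR12_sqrt ?sqnorm_ge0//.
  have := sqnorm_ge0 (u n); case: (sqnorm (u n)) => [r| |]//=.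
  rewrite lee_fin lte_fin => r0 re; exists (Num.sqrt r) => //.
  rewrite ger0_norm ?sqrtr_ge0// -[ltRHS]ger0_norm ?ltW// -sqrtr_sqr.
  by rewrite ltr_sqrt// exprn_gt0.
apply/fine_cvgP; split.
  by apply: filterS (key 1 ltr01) => n [r -> _].
apply/cvgr0Pnorm_lt => e e0; apply: filterS (key e e0) => n [r + re] /=.
by move=> ->.
Unshelve. all: by end_near. Qed.

Lemma L2D f g : L2 f -> L2 g -> L2 (fun x => f x + g x).
Proof.
move=> [mf foo] [mg goo]; split; first exact: cmeasurableD.
apply: (@le_lt_trans _ _ (2%:E * sqnorm f + 2%:E * sqnorm g)%E); last first.
  by rewrite lte_add_pinfty// lte_mul_pinfty.
rewrite -!ge0_integralZl//; [|exact: measurable_sqr_normc|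
  by move=> x _; rewrite lee_fin sqr_ge0|exact: measurable_sqr_normc|
  by move=> x _; rewrite lee_fin sqr_ge0].
rewrite -ge0_integralD//; [|by move=> x _; rewrite mule_ge0 ?lee_fin ?sqr_ge0|
  by apply: measurable_funeM; exact: measurable_sqr_normc|
  by move=> x _; rewrite mule_ge0 ?lee_fin ?sqr_ge0|
  by apply: measurable_funeM; exact: measurable_sqr_normc].
apply: ge0_le_integral => //.
- by move=> x _; rewrite lee_fin sqr_ge0.
- by apply: measurable_sqr_normc; exact: cmeasurableD.
- by apply: emeasurable_funD; apply: measurable_funeM; exact: measurable_sqr_normc.
- by move=> x _; rewrite -!EFinM -EFinD lee_fin sqr_normcD_le.
Qed.

Lemma sqnormZ (c : R[i]) f : cmeasurable f ->
  sqnorm (fun x => c * f x) = ((normc c ^+ 2)%:E * sqnorm f)%E.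
Proof.
move=> mf; rewrite -ge0_integralZl//; [|exact: measurable_sqr_normc|
  by move=> x _; rewrite lee_fin sqr_ge0|by rewrite lee_fin sqr_ge0].
by apply: eq_integral => x _; rewrite normcM exprMn.
Qed.

Lemma L2Z (c : R[i]) f : L2 f -> L2 (fun x => c * f x).
Proof.
move=> [mf foo]; split; first by apply: cmeasurableM => //; exact: cmeasurable_cst.
by rewrite sqnormZ// lte_mul_pinfty// lee_fin sqr_ge0.
Qed.

Lemma L2B f g : L2 f -> L2 g -> L2 (fun x => f x - g x).
Proof.
move=> lf lg; rewrite (_ : (fun x => _) = (fun x => f x + (-1) * g x)).
  by apply: L2D => //; exact: L2Z.
by apply/funext => x; rewrite mulN1r.
Qed.

Lemma L2_conj f : L2 f -> L2 (fun x => (f x)^*).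
Proof.
move=> [mf foo]; split; first exact: cmeasurable_conj.
by rewrite (@eq_sqnorm _ f)// => x; rewrite normc_conj.
Qed.

(** Only finiteness is at stake, so the crude bound |f g| <= |f|^2 + |g|^2 suffices. *)
Lemma L2_mul_cintegrable f g : L2 f -> L2 g ->
  cintegrable mu setT (fun x => f x * g x).
Proof.
move=> [mf foo] [mg goo]; apply: (@cintegrable_le _ _ _ _ _
    (fun x => (normc (f x) ^+ 2)%:E + (normc (g x) ^+ 2)%:E)%E).
- exact: cmeasurableM.
- by apply: emeasurable_funD; exact: measurable_sqr_normc.
- by move=> x; rewrite -EFinD lee_fin normcM_le.
- rewrite ge0_integralD//; [exact: lte_add_pinfty|
    by move=> x _; rewrite lee_fin sqr_ge0|exact: measurable_sqr_normc|
    by move=> x _; rewrite lee_fin sqr_ge0|exact: measurable_sqr_normc].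
Qed.

Lemma L2_cdot_cintegrable f g : L2 f -> L2 g ->
  cintegrable mu setT (fun x => f x * (g x)^*).
Proof. by move=> lf lg; apply: L2_mul_cintegrable => //; exact: L2_conj. Qed.

Lemma cdotDl f1 f2 g : L2 f1 -> L2 f2 -> L2 g ->
  cdot mu (fun x => f1 x + f2 x) g = cdot mu f1 g + cdot mu f2 g.
Proof.
move=> l1 l2 lg; rewrite /cdot -cintegralD; [|exact: L2_cdot_cintegrable..].
by apply: eq_cintegral => x _; rewrite mulrDl.
Qed.

Lemma cdotZl (c : R[i]) f g : L2 f -> L2 g ->
  cdot mu (fun x => c * f x) g = c * cdot mu f g.
Proof.
move=> lf lg; rewrite /cdot -cintegralZ; last exact: L2_cdot_cintegrable.
by apply: eq_cintegral => x _; rewrite mulrA.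
Qed.

Lemma cdot_conj f g : L2 f -> L2 g -> cdot mu g f = (cdot mu f g)^*.
Proof.
move=> lf lg; rewrite /cdot -cintegral_conj; last exact: L2_cdot_cintegrable.
by apply: eq_cintegral => x _; rewrite cconjM cconjK mulrC.
Qed.

Lemma cdotBl f1 f2 g : L2 f1 -> L2 f2 -> L2 g ->
  cdot mu (fun x => f1 x - f2 x) g = cdot mu f1 g - cdot mu f2 g.
Proof.
move=> l1 l2 lg; rewrite (_ : (fun x => _) = (fun x => f1 x + (-1) * f2 x)).
  by rewrite cdotDl ?cdotZl ?mulN1r//; exact: L2Z.
by apply/funext => x; rewrite mulN1r.
Qed.

Lemma cdotBr f g1 g2 : L2 f -> L2 g1 -> L2 g2 ->
  cdot mu f (fun x => g1 x - g2 x) = cdot mu f g1 - cdot mu f g2.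
Proof.
move=> lf l1 l2; have lB := L2B l1 l2.
by rewrite (cdot_conj lB lf) cdotBl// cconjB -!cdot_conj.
Qed.

Lemma cdotZr (c : R[i]) f g : L2 f -> L2 g ->
  cdot mu f (fun x => c * g x) = c^* * cdot mu f g.
Proof.
move=> lf lg; have lZ := L2Z c lg.
by rewrite (cdot_conj lZ lf) cdotZl// cconjM -cdot_conj.
Qed.

Lemma cdot_sqnorm f : L2 f -> cdot mu f f = (fine (sqnorm f))%:C.
Proof.
move=> lf; rewrite /cdot /cintegral; apply/eqP; rewrite eq_complex /=.
apply/andP; split; apply/eqP.
  by apply: eq_Rintegral => x _; rewrite mulc_conj.
(* The zero on the right is written as an integral over the empty set, then over the whole space, so
   that integrands can be compared pointwise. *)
rewrite -[RHS](@Rintegral_set0 _ _ _ mu (fun=> 0)) [in RHS]Rintegral_mkcond.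
by apply: eq_Rintegral => x _; rewrite mulc_conj patchE; case: ifP.
Qed.

Lemma normcM_integral_le f g : cmeasurable f -> cmeasurable g ->
  (\int[mu]_x (normc (f x) * normc (g x))%:E <=
   sqnorm f `^ 2^-1 * sqnorm g `^ 2^-1)%E.
Proof.
move=> mf mg.
have := @hoelder _ _ _ mu (fun x => normc (f x)) (fun x => normc (g x)) 2 2
  (measurable_normc mf) (measurable_normc mg).
rewrite Lnorm1 -!cLnorm2E.
under eq_integral do rewrite gee0_abs ?lee_fin ?mulr_ge0 ?normc_ge0//.
by apply => //; rewrite -div1r -mulrDl divff.
Qed.

(** Cauchy-Schwarz in squared form: Hoelder with both exponents 2, after the modulus is moved under
    the integral. *)
Lemma sqr_cdot_le f g : L2 f -> L2 g ->
  normc (cdot mu f g) ^+ 2 <= fine (sqnorm f) * fine (sqnorm g).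
Proof.
move=> lf lg; have ifg := L2_cdot_cintegrable lf lg.
have := normc_cintegral_le ifg.
under eq_integral do rewrite normcM normc_conj.
move=> /le_trans/(_ (normcM_integral_le (L2_meas lf) (L2_meas lg))).
have := sqnorm_ge0 f; have := sqnorm_ge0 g.
rewrite -(L2_fin lf) -(L2_fin lg) !lee_fin/= => g0 f0.
rewrite !powR12_sqrt// -sqrtrM// -/(cdot mu f g) => h.
rewrite -[leRHS]sqr_sqrtr ?mulr_ge0// ler_pXn2r ?nnegrE ?normc_ge0 ?sqrtr_ge0//.
Qed.

Lemma fine_sqnormD f g : L2 f -> L2 g ->
  fine (sqnorm (fun x => f x + g x)) =
  fine (sqnorm f) + fine (sqnorm g) + 2 * complex.Re (cdot mu f g).
Proof.
move=> lf lg; have lD := L2D lf lg.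
have := cdot_sqnorm lD; rewrite cdotDl// (cdot_conj lD lf) (cdot_conj lD lg).
rewrite !cdotDl// !cconjD -!cdot_conj// !cdot_sqnorm//.
rewrite (cdot_conj lf lg); case: (cdot mu f g) => a b /= [<- _].
by ring.
Qed.

End SquareNorm.

(** * Polarization and continuity of the inner product *)

Section Polarization.
Context {d d'} {T : measurableType d} {T' : measurableType d'} {R : realType}.
Variables (mu : {measure set T -> \bar R}) (nu : {measure set T' -> \bar R}).

(** Expanding the squared norm of f + a g at a = 0, 1 and i isolates the norm of f and the real and
    imaginary parts of the inner product. The hypothesis on [g'] removes the term in |a|^2. *)
Lemma cdot_polarization (c : R) (f g : T -> R[i]) (f' g' : T' -> R[i]) :
  L2 mu f -> L2 mu g -> L2 nu f' -> L2 nu g' ->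
  (forall a : R[i], sqnorm nu (fun x => f' x + a * g' x) =
     (c%:E * sqnorm mu (fun x => (f x + a * g x)%R))%E) ->
  sqnorm nu g' = (c%:E * sqnorm mu g)%E ->
  cdot nu f' g' = c%:C * cdot mu f g.
Proof.
move=> lf lg lf' lg' fg gg.
have key a : fine (sqnorm nu f') + 2 * complex.Re (a^* * cdot nu f' g') =
    c * (fine (sqnorm mu f) + 2 * complex.Re (a^* * cdot mu f g)).
  have := fg a; rewrite -(L2_fin (L2D lf' (L2Z a lg'))).
  rewrite -(L2_fin (L2D lf (L2Z a lg))) -EFinM => -[].
  rewrite !fine_sqnormD//; [|exact: L2Z..].
  rewrite !cdotZr// !sqnormZ; [|exact: L2_meas lg|exact: L2_meas lg'].
  rewrite gg -(L2_fin lg) -!EFinM /= => h.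
  apply: (@addIr _ (normc a ^+ 2 * (c * fine (sqnorm mu g)))).
  by rewrite addrAC h; ring.
have Rei (z : R[i]) : complex.Re (('i%C)^* * z) = complex.Im z.
  by case: z => a b /=; rewrite !mul0r mulN1r opprK add0r.
have k0 := key 0; have k1 := key 1; have ki := key 'i%C.
rewrite !Rei in ki; rewrite rmorph1 !mul1r in k1; rewrite rmorph0 !mul0r in k0.
rewrite /= !mulr0 !addr0 in k0.
have {}k1 : complex.Re (cdot nu f' g') = c * complex.Re (cdot mu f g) by lra.
have {}ki : complex.Im (cdot nu f' g') = c * complex.Im (cdot mu f g) by lra.
rewrite [LHS]complex_ReIm k1 ki; case: (cdot mu f g) => a b /=.
by apply/eqP; rewrite eq_complex /=; apply/andP; split; apply/eqP; ring.
Qed.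

(** By Cauchy-Schwarz the inner product is continuous in its second argument, so an identity between
    two L^2 spaces passes to the limit. This extends both the Fourier formula to a square-integrable
    wavelet and the isometry to all of L^2. *)
Lemma cdot_lim (c : R[i]) (f v : T -> R[i]) (f' v' : T' -> R[i])
    (u : nat -> T -> R[i]) (u' : nat -> T' -> R[i]) :
  L2 mu f -> L2 mu v -> L2 nu f' -> L2 nu v' ->
  (forall n, L2 mu (u n)) -> (forall n, L2 nu (u' n)) ->
  (forall e : R, 0 < e ->
    \forall n \near \oo, (sqnorm mu (fun x => (u n x - v x)%R) < e%:E)%E) ->
  (forall e : R, 0 < e ->
    \forall n \near \oo, (sqnorm nu (fun x => (u' n x - v' x)%R) < e%:E)%E) ->
  (forall n, c * cdot mu f (u n) = cdot nu f' (u' n)) ->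
  c * cdot mu f v = cdot nu f' v'.
Proof.
move=> lf lv lf' lv' lu lu' cu cu' uu'.
(* [M] collects the factors of e / M in the two Cauchy-Schwarz bounds; the final 1 makes it
   positive. *)
pose M := 2 * (normc c ^+ 2 * fine (sqnorm mu f)) + 2 * fine (sqnorm nu f') + 1.
have f0 : 0 <= fine (sqnorm mu f) by rewrite fine_ge0 ?sqnorm_ge0.
have f'0 : 0 <= fine (sqnorm nu f') by rewrite fine_ge0 ?sqnorm_ge0.
have M0 : 0 < M.
  by have := mulr_ge0 (sqr_ge0 (normc c)) f0; rewrite /M; lra.
apply/eqP; rewrite -subr_eq0 -normc_eq0 -sqrf_eq0.
rewrite eq_le sqr_ge0 andbT; apply/ler_addgt0Pr => e e0; rewrite add0r.
have e'0 : 0 < e / M by rewrite divr_gt0.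
have [n [un un']] : exists n, (sqnorm mu (fun x => (u n x - v x)%R) < (e / M)%:E)%E /\
    (sqnorm nu (fun x => (u' n x - v' x)%R) < (e / M)%:E)%E.
  by have [n _ /(_ n (leqnn n))] := filterI (cu _ e'0) (cu' _ e'0); exists n.
have := L2B (lu n) lv; have := L2B (lu' n) lv'.
move: un un'; set w := (fun x => _); set w' := (fun x => _) => wn wn' lw' lw.
rewrite (_ : c * _ - _ = cdot nu f' w' - c * cdot mu f w); last first.
  by rewrite /w /w' !cdotBr// mulrBr uu'; ring.
move: wn wn'; rewrite -(L2_fin lw) -(L2_fin lw') !lte_fin => wn wn'.
have h := sqr_cdot_le lf lw; have h' := sqr_cdot_le lf' lw'.
rewrite (le_trans (sqr_normcD_le _ _))// normcN normcM exprMn.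
have w0 : 0 <= fine (sqnorm mu w) by rewrite fine_ge0 ?sqnorm_ge0.
have w'0 : 0 <= fine (sqnorm nu w') by rewrite fine_ge0 ?sqnorm_ge0.
apply: (@le_trans _ _ (M * (e / M))); last by rewrite mulrCA divff ?gt_eqF// mulr1.
have h1 : normc (cdot nu f' w') ^+ 2 <= fine (sqnorm nu f') * (e / M).
  by rewrite (le_trans h')// ler_wpM2l// ltW.
have h2 : normc (cdot mu f w) ^+ 2 <= fine (sqnorm mu f) * (e / M).
  by rewrite (le_trans h)// ler_wpM2l// ltW.
have h3 := ler_wpM2l (sqr_ge0 (normc c)) h2.
move: (e / M) e'0 h1 h2 h3 => e' e'0 h1 h2 h3; rewrite /M; lra.
Qed.

End Polarization.

(** * Limit theorems for squared norms *)

Section SquareNormLimits.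
Context {d} {T : measurableType d} {R : realType}.
Variable mu : {measure set T -> \bar R}.
Implicit Types (f g : T -> R[i]).

Lemma indicM_if (F : set T) x f :
  (\1_F x)%:C * f x = if x \in F then f x else 0 :> R[i].
Proof. by rewrite indicE; case: (x \in F); rewrite ?mul1r ?mul0r. Qed.

Lemma cmeasurable_indicM (F : set T) f : measurable F -> cmeasurable f ->
  cmeasurable (fun x => (\1_F x)%:C * f x : R[i]).
Proof.
move=> mF mf; apply: cmeasurableM => //; apply: cmeasurable_real.
exact: measurable_indic.
Qed.

Lemma L2_indicM (F : set T) f : measurable F -> L2 mu f ->
  L2 mu (fun x => (\1_F x)%:C * f x).
Proof.
move=> mF lf; apply: L2_le (lf) _.
  by apply: cmeasurable_indicM => //; exact: L2_meas lf.
move=> x; rewrite indicM_if; case: ifPn => // _.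
by rewrite normc0 normc_ge0.
Qed.

(** Dominated convergence under |f|^2. Only the points where f is nonzero have to be exhausted,
    which leaves room for scale boxes, none of which meets a = 0. *)
Lemma sqnorm_indicM_cvg (F : nat -> set T) f :
  (forall n, measurable (F n)) -> nondecreasing_seq F ->
  (forall x, f x != 0 -> exists n, F n x) -> L2 mu f ->
  forall e : R, 0 < e -> \forall n \near \oo,
    (sqnorm mu (fun x => ((\1_(F n) x)%:C * f x - f x)%R) < e%:E)%E.
Proof.
move=> mF ndF Ff lf.
have mf := L2_meas lf.
pose h n x := ((normc ((\1_(F n) x)%:C * f x - f x)) ^+ 2)%:E.
have mh n : measurable_fun setT (h n).
  by apply: measurable_sqr_normc; apply: cmeasurableB => //; exact: cmeasurable_indicM.
have := @dominated_convergence _ _ _ mu setT measurableT h (cst 0%E)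
  (fun x => (normc (f x) ^+ 2)%:E) mh (measurable_cst _).
case.
- apply: aeW => x _ /=.
  have [fx0|/Ff[n Fn]] := eqVneq (f x) 0.
    rewrite (_ : h^~ x = cst 0%E); first exact: cvg_cst.
    by apply/funext => n; rewrite /h fx0 mulr0 subrr normc0 expr0n.
  apply: cvg_near_cst; exists n => // m /= nm.
  rewrite /h indicM_if mem_set ?subrr ?normc0 ?expr0n//.
  by have /subsetPset := ndF n m nm; exact.
- apply/integrableP; split; first exact: measurable_sqr_normc.
  under eq_integral do rewrite gee0_abs ?lee_fin ?sqr_ge0//.
  by case: lf.
- apply: aeW => x n _; rewrite /h gee0_abs ?lee_fin ?sqr_ge0// indicM_if.
  case: ifPn => _; first by rewrite subrr normc0 expr0n sqr_ge0.
  by rewrite sub0r normcN.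
move=> _ _; rewrite integral0 => /fine_cvgP[hfin /cvgr0Pnorm_lt h0] e e0.
near=> n.
have : `|fine (\int[mu]_x h n x)%E| < e by near: n; exact: h0.
have : (\int[mu]_x h n x)%E \is a fin_num by near: n; exact: hfin.
rewrite -/(sqnorm mu _); have := sqnorm_ge0 mu (fun x => (\1_(F n) x)%:C * f x - f x).
case: (sqnorm _ _) => // r; rewrite lee_fin lte_fin => r0 _ /=.
by rewrite ger0_norm.
Unshelve. all: by end_near. Qed.

(** Convergence at every point is available in the application: by Cauchy-Schwarz the coefficients
    against a fixed family converge at each parameter. *)
Lemma sqnorm_fatou (u : nat -> T -> R[i]) (v : T -> R[i]) (M : \bar R) :
  (forall n, cmeasurable (u n)) ->
  (forall x, (fun n => normc (u n x - v x)) @ \oo --> (0 : R)) ->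
  (forall n, (sqnorm mu (u n) <= M)%E) -> (sqnorm mu v <= M)%E.
Proof.
move=> mu_ uv uM.
have nuv x : (normc (u n x) ^+ 2)%:E @[n --> \oo] --> (normc (v x) ^+ 2)%:E.
  apply: cvg_EFin; first exact: nearW.
  rewrite expr2 /comp /=; under eq_fun do rewrite expr2.
  suff h : normc (u n x) @[n --> \oo] --> normc (v x) by exact: cvgM.
  apply/cvgrPdist_le => e e0.
  have /cvgr0Pnorm_le/(_ _ e0) := uv x.
  apply: filterS => n; rewrite ger0_norm ?normc_ge0//; apply: le_trans.
  have h1 := le_normcD (u n x - v x) (v x); rewrite subrK in h1.
  have h2 := le_normcD (v x - u n x) (u n x); rewrite subrK -opprB normcN in h2.
  by rewrite ler_norml; apply/andP; split; lra.
have := fatou mu measurableT (fun n => measurable_sqr_normc (mu_ n)).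
have n0 n x : [set: T] x -> (0 <= (normc (u n x) ^+ 2)%:E)%E.
  by rewrite lee_fin sqr_ge0.
move=> /(_ n0); rewrite /sqnorm.
under eq_integral => x _.
  rewrite is_cvg_limn_einfE; last exact: cvgP (nuv x).
  rewrite (cvg_lim _ (nuv x)).
    over.
  by [].
move=> /le_trans; apply.
rewrite limn_einf_lim; apply: lime_le; first exact: is_cvg_einfs.
apply: nearW => n; apply: le_trans (uM n).
by apply: ereal_inf_lbound; exists n => /=.
Qed.

(** L^2 convergence to 0 gives no pointwise limit, but by Fatou the lower limit of |v_n|^2 vanishes
    almost everywhere. Wherever a limit exists it is then 0, and no subsequence has to be
    extracted. *)
Lemma sqnorm_cvg0_ae (v : nat -> T -> R[i]) :
  (forall n, cmeasurable (v n)) ->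
  (forall e : R, 0 < e -> \forall n \near \oo, (sqnorm mu (v n) < e%:E)%E) ->
  {ae mu, forall x, forall l : R,
    (fun n => normc (v n x)) @ \oo --> l -> l = 0}.
Proof.
move=> mv v0.
pose g x := limn_einf (fun n => (normc (v n x) ^+ 2)%:E).
have g0 x : (0 <= g x)%E.
  rewrite /g limn_einf_lim; apply: lime_ge; first exact: is_cvg_einfs.
  apply: nearW => n; apply: le_ereal_inf_tmp => _ [m _ <-].
  by rewrite lee_fin sqr_ge0.
have mg : measurable_fun setT g.
  rewrite (_ : g = fun x => - limn_esup (fun n => - (normc (v n x) ^+ 2)%:E))%E//.
  apply: measurableT_comp => //; apply: measurable_fun_limn_esup => n.
  by apply: measurableT_comp => //; exact: measurable_sqr_normc.
have ig : (\int[mu]_x `|g x| = 0)%E.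
  under eq_integral do rewrite gee0_abs//.
  apply/eqP; rewrite eq_le integral_ge0// andbT.
  have n0 n x : [set: T] x -> (0 <= (normc (v n x) ^+ 2)%:E)%E.
    by rewrite lee_fin sqr_ge0.
  apply: le_trans (fatou mu measurableT (fun n => measurable_sqr_normc (mv n)) n0) _.
  apply/lee_addgt0Pr => e e0; rewrite add0e.
  rewrite limn_einf_lim; apply: lime_le; first exact: is_cvg_einfs.
  have [N _ Nv] := v0 e e0; near=> n.
  apply: le_trans (ltW (Nv (maxn n N) (leq_maxr _ _))).
  by apply: ereal_inf_lbound; exists (maxn n N) => //=; exact: leq_maxl.
move/(ae_eq_integral_abs mu measurableT mg) : ig.
apply: filterS => x /(_ I) gx0 l vl.
have : (normc (v n x) ^+ 2)%:E @[n --> \oo] --> (l ^+ 2)%:E.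
  apply: cvg_EFin; first exact: nearW.
  by rewrite expr2 /comp /=; under eq_fun do rewrite expr2; exact: cvgM.
move=> vl2; move: gx0; rewrite /g is_cvg_limn_einfE; last exact: cvgP vl2.
by rewrite (cvg_lim _ vl2)// => -[/eqP]; rewrite sqrf_eq0 => /eqP.
Unshelve. all: by end_near. Qed.

End SquareNormLimits.

(** * Product measures and Fubini for complex functions *)

Section ProductSigmaFinite.
Context {d1 d2} {T1 : measurableType d1} {T2 : measurableType d2}
  {R : realType}.
Variables (m1 : {sigma_finite_measure set T1 -> \bar R})
  (m2 : {sigma_finite_measure set T2 -> \bar R}).

Lemma product_sigma_finite : sigma_finite setT (m1 \x m2)%E.
Proof.
have /sigma_finiteP[F [FT ndF Ffin]] := sigma_finiteT m1.
have /sigma_finiteP[G [GT ndG Gfin]] := sigma_finiteT m2.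
exists (fun n => F n `*` G n) => [|n].
  apply/seteqP; split=> // -[x y] _.
  have : setT x by []. have : setT y by [].
  rewrite FT GT => -[k _ Gy] [n _ Fx]; exists (maxn n k) => //; split => /=.
  - by move/subsetPset : (ndF _ _ (leq_maxl n k)); exact.
  - by move/subsetPset : (ndG _ _ (leq_maxr n k)); exact.
have [mF Foo] := Ffin n; have [mG Goo] := Gfin n.
split; first exact: measurableX.
by rewrite product_measure1E// lte_mul_pinfty// ge0_fin_numE.
Qed.

(* Canonical structure inference only finds the library's sigma-finite product
   for subprobabilities. *)
Definition sigma_finite_product :
    {sigma_finite_measure set (T1 * T2)%type -> \bar R} :=
  HB.pack (m1 \x m2)%E
    (Measure_isSigmaFinite.Build _ _ _ (m1 \x m2)%E product_sigma_finite).

End ProductSigmaFinite.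

Section ComplexFubini.
Context {d1 d2} {T1 : measurableType d1} {T2 : measurableType d2}
  {R : realType}.
Variables (m1 : {sigma_finite_measure set T1 -> \bar R})
  (m2 : {sigma_finite_measure set T2 -> \bar R}).
Implicit Types F : T1 * T2 -> R[i].

(** No integrability is assumed: the partial integrals of the positive and negative parts are
    measurable by Tonelli, and so is [fine] of their difference. *)
Let measurable_Rintegral1 (f : T1 * T2 -> R) : measurable_fun setT f ->
  measurable_fun setT (fun y => Rintegral m1 setT (fun x => f (x, y))).
Proof.
move=> mf; apply: measurableT_comp; first exact: fine_measurable.
have mEf : measurable_fun setT (EFin \o f) by exact/measurable_EFinP.
rewrite (_ : (fun _ => _) = fubini_G m1 (EFin \o f)^\+ \-
    fubini_G m1 (EFin \o f)^\-)%E; last first.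
  apply/funext => z; rewrite integralE.
  by congr (_ - _)%E; apply: eq_integral => t _; rewrite ?funeposE ?funenegE.
apply: emeasurable_funB.
  by apply: measurable_fun_fubini_tonelli_G => //; exact: measurable_funepos.
by apply: measurable_fun_fubini_tonelli_G => //; exact: measurable_funeneg.
Qed.

Let measurable_Rintegral2 (f : T1 * T2 -> R) : measurable_fun setT f ->
  measurable_fun setT (fun x => Rintegral m2 setT (fun y => f (x, y))).
Proof.
move=> mf; apply: measurableT_comp; first exact: fine_measurable.
have mEf : measurable_fun setT (EFin \o f) by exact/measurable_EFinP.
rewrite (_ : (fun _ => _) = fubini_F m2 (EFin \o f)^\+ \-
    fubini_F m2 (EFin \o f)^\-)%E; last first.
  apply/funext => z; rewrite integralE.
  by congr (_ - _)%E; apply: eq_integral => t _; rewrite ?funeposE ?funenegE.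
apply: emeasurable_funB.
  by apply: measurable_fun_fubini_tonelli_F => //; exact: measurable_funepos.
by apply: measurable_fun_fubini_tonelli_F => //; exact: measurable_funeneg.
Qed.

Lemma cmeasurable_cintegral1 F : cmeasurable F ->
  cmeasurable (fun y => cintegral m1 setT (fun x => F (x, y))).
Proof.
by move=> [FR FI]; split; [exact: measurable_Rintegral1 FR|exact: measurable_Rintegral1 FI].
Qed.

Lemma cmeasurable_cintegral2 F : cmeasurable F ->
  cmeasurable (fun x => cintegral m2 setT (fun y => F (x, y))).
Proof.
by move=> [FR FI]; split; [exact: measurable_Rintegral2 FR|exact: measurable_Rintegral2 FI].
Qed.

(** Sections are integrable at every point, not just almost everywhere, so each inner integral is
    finite and [fine] can be removed before Fubini for extended reals applies. *)
Let Rfubini (f : T1 * T2 -> R) :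
  (m1 \x m2)%E.-integrable setT (EFin \o f) ->
  (forall x, m2.-integrable setT (fun y => (f (x, y))%:E)) ->
  (forall y, m1.-integrable setT (fun x => (f (x, y))%:E)) ->
  Rintegral m1 setT (fun x => Rintegral m2 setT (fun y => f (x, y))) =
  Rintegral m2 setT (fun y => Rintegral m1 setT (fun x => f (x, y))).
Proof.
move=> fi fi2 fi1; rewrite /Rintegral; congr fine.
under eq_integral do rewrite fineK ?integrable_fin_num//.
under [RHS]eq_integral do rewrite fineK ?integrable_fin_num//.
exact: (Fubini fi).
Qed.

Lemma cintegral_fubini F : cintegrable (m1 \x m2)%E setT F ->
  (forall x, cintegrable m2 setT (fun y => F (x, y))) ->
  (forall y, cintegrable m1 setT (fun x => F (x, y))) ->
  cintegral m1 setT (fun x => cintegral m2 setT (fun y => F (x, y))) =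
  cintegral m2 setT (fun y => cintegral m1 setT (fun x => F (x, y))).
Proof.
move=> [FR FI] F2 F1; rewrite {1}/cintegral {4}/cintegral /=; congr (_ +i* _).
- by apply: (Rfubini FR) => [x|y]; [have [] := F2 x|have [] := F1 y].
- by apply: (Rfubini FI) => [x|y]; [have [] := F2 x|have [] := F1 y].
Qed.

Lemma sqnorm_tonelli1 F : cmeasurable F ->
  sqnorm (m1 \x m2)%E F = (\int[m1]_x sqnorm m2 (fun y => F (x, y)))%E.
Proof.
move=> mF; rewrite /sqnorm fubini_tonelli1//.
- exact: measurable_sqr_normc.
- by move=> x; rewrite lee_fin sqr_ge0.
Qed.

Lemma sqnorm_tonelli2 F : cmeasurable F ->
  sqnorm (m1 \x m2)%E F = (\int[m2]_y sqnorm m1 (fun x => F (x, y)))%E.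
Proof.
move=> mF; rewrite /sqnorm fubini_tonelli2//.
- exact: measurable_sqr_normc.
- by move=> x; rewrite lee_fin sqr_ge0.
Qed.

(** Tonelli factors the squared norm. Multiplying such a tensor by a square-integrable kernel gives
    the integrability that Fubini asks for in [cdot_synthesis]. *)
Lemma L2_tensor (f : T1 -> R[i]) (g : T2 -> R[i]) : L2 m1 f -> L2 m2 g ->
  L2 (m1 \x m2)%E (fun p => f p.1 * g p.2).
Proof.
move=> [mf foo] [mg goo].
have mfg : cmeasurable (fun p : T1 * T2 => f p.1 * g p.2).
  by apply: cmeasurableM; [exact: cmeasurable_comp measurable_fst mf|
    exact: cmeasurable_comp measurable_snd mg].
split=> //; rewrite sqnorm_tonelli1//.
rewrite (eq_integral (fun x => (normc (f x) ^+ 2)%:E * sqnorm m2 g))%E; last first.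
  by move=> x _; exact: (sqnormZ m2 (f x) mg).
rewrite ge0_integralZr ?sqnorm_ge0//.
- rewrite lte_mul_pinfty ?sqnorm_ge0// -/(sqnorm m1 f) ge0_fin_numE ?sqnorm_ge0//.
- exact: measurable_sqr_normc.
- by move=> x _; rewrite lee_fin sqr_ge0.
Qed.

End ComplexFubini.

Section L1Limit.
Context {d} {T : measurableType d} {R : realType}.
Variable mu : {measure set T -> \bar R}.

(* Dominated convergence enters through [sqnorm_indicM_cvg], applied to the
   square root of |f|. *)
Lemma cintegral_indicM_cvg (F : nat -> set T) (f : T -> R[i]) :
  (forall n, measurable (F n)) -> nondecreasing_seq F ->
  (forall x, f x != 0 -> exists n, F n x) -> cintegrable mu setT f ->
  (fun n => normc (cintegral mu setT (fun x => (\1_(F n) x)%:C * f x) -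
                   cintegral mu setT f)) @ \oo --> (0 : R).
Proof.
move=> mF ndF Ff fi.
have mf := cintegrable_meas fi.
pose s x : R[i] := (Num.sqrt (normc (f x)))%:C.
have ns x : normc (s x) ^+ 2 = normc (f x).
  by rewrite normc_real ger0_norm ?sqrtr_ge0// sqr_sqrtr ?normc_ge0.
have ms : cmeasurable s.
  apply: cmeasurable_real; apply: (measurableT_comp
    (continuous_measurable_fun (@sqrt_continuous R))) => //.
  exact: measurable_normc.
have ls : L2 mu s.
  split=> //; rewrite /sqnorm; under eq_integral do rewrite ns.
  by case/cintegrableP : fi.
have Fs x : s x != 0 -> exists n, F n x.
  move=> sx; apply: Ff; apply: contra_neq sx => fx.
  by rewrite /s fx normc0 sqrtr0.
have := sqnorm_indicM_cvg mF ndF Fs ls => h.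
apply/cvgr0Pnorm_lt => e e0; have := h _ e0; apply: filterS => n.
rewrite ger0_norm ?normc_ge0//.
have iF : cintegrable mu setT (fun x => (\1_(F n) x)%:C * f x).
  apply: (cintegrable_le _ (measurable_normcE mf)).
  - exact: cmeasurable_indicM.
  - move=> x; rewrite lee_fin indicM_if; case: ifP => // _.
    by rewrite normc0 normc_ge0.
  - by case/cintegrableP : fi.
have iN := cintegrableZ (-1) fi.
rewrite (_ : _ - _ = cintegral mu setT (fun x => (\1_(F n) x)%:C * f x + (-1) * f x)).
  rewrite -lte_fin; apply: le_lt_trans.
  apply: le_trans (normc_cintegral_le (cintegrableD iF iN)) _.
  rewrite le_eqVlt; apply/orP; left; apply/eqP; apply: eq_integral => x _.
  rewrite mulN1r !indicM_if; case: ifP => _.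
    by rewrite !subrr normc0 expr0n.
  by rewrite !sub0r !normcN ns.
by rewrite cintegralD// cintegralZ// mulN1r.
Qed.

End L1Limit.

(** * Resolutions of the identity *)

Section Resolution.
Context {dX dZ} {X : measurableType dX} {Z : measurableType dZ} {R : realType}.
Variables (mu : {sigma_finite_measure set X -> \bar R})
  (nu : {sigma_finite_measure set Z -> \bar R}).
Variable h : Z -> X -> R[i].
Hypothesis mh : cmeasurable (fun p : Z * X => h p.1 p.2).
Hypothesis hL2 : forall z, L2 mu (h z).

(** The analysis operator of the family [h]. Under [isometry] below, [h] is a continuous tight frame
    with constant [c]; no property of wavelets enters this section. *)
Definition analysis (f : X -> R[i]) (z : Z) : R[i] := cdot mu f (h z).

Lemma cmeasurable_analysis f : cmeasurable f -> cmeasurable (analysis f).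
Proof.
move=> mf; apply: (@cmeasurable_cintegral2 _ _ _ _ _ mu
  (fun p : Z * X => f p.2 * (h p.1 p.2)^*)).
apply: cmeasurableM; first exact: cmeasurable_comp measurable_snd mf.
exact: cmeasurable_conj.
Qed.

Lemma analysisD f g : L2 mu f -> L2 mu g ->
  analysis (fun x => f x + g x) = (fun z => analysis f z + analysis g z).
Proof. by move=> lf lg; apply/funext => z; rewrite /analysis cdotDl. Qed.

Lemma analysisZ a f : L2 mu f ->
  analysis (fun x => a * f x) = (fun z => a * analysis f z).
Proof. by move=> lf; apply/funext => z; rewrite /analysis cdotZl. Qed.

Lemma analysisB f g : L2 mu f -> L2 mu g ->
  analysis (fun x => f x - g x) = (fun z => analysis f z - analysis g z).
Proof. by move=> lf lg; apply/funext => z; rewrite /analysis cdotBl. Qed.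

Variable c : R.
Hypothesis c_gt0 : 0 < c.
Hypothesis isometry : forall f, L2 mu f ->
  sqnorm nu (analysis f) = (c%:E * sqnorm mu f)%E.

Lemma L2_analysis f : L2 mu f -> L2 nu (analysis f).
Proof.
move=> lf; split; first exact: cmeasurable_analysis (L2_meas lf).
by rewrite isometry// lte_mul_pinfty ?lee_fin ?(ltW c_gt0)//; case: lf.
Qed.

Lemma cdot_analysis f g : L2 mu f -> L2 mu g ->
  cdot nu (analysis f) (analysis g) = c%:C * cdot mu f g.
Proof.
move=> lf lg; apply: cdot_polarization => //; [exact: L2_analysis..| |exact: isometry].
by move=> a; rewrite -isometry ?analysisD ?analysisZ//; [exact: L2Z|
  apply: L2D => //; exact: L2Z].
Qed.

Lemma real_complexVK : (c%:C)^-1 * c%:C = 1 :> R[i].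
Proof.
apply: mulVf; apply/eqP => -[] c0; by move: c_gt0; rewrite c0 ltxx.
Qed.

(** An exhaustion of the parameter space, up to parameters where [h] vanishes. [hE] makes the
    truncated integral meaningful at each fixed x; [hE2] makes the truncated kernel square
    integrable on the product, as Fubini requires. *)
Variable E : nat -> set Z.
Hypothesis mE : forall n, measurable (E n).
Hypothesis ndE : nondecreasing_seq E.
Hypothesis coverE : forall z, (exists n, E n z) \/ (forall x, h z x = 0).
Hypothesis hE : forall n x, (sqnorm nu (fun z => (\1_(E n) z)%:C * h z x)%R < +oo)%E.
Hypothesis hE2 : forall n,
  (\int[nu]_z sqnorm mu (fun x => (\1_(E n) z)%:C * h z x)%R < +oo)%E.

Let k n (z : Z) (x : X) : R[i] := (\1_(E n) z)%:C * h z x.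

Let mk n : cmeasurable (fun p : Z * X => k n p.1 p.2).
Proof.
apply: cmeasurableM => //; apply: cmeasurable_real.
by apply: (measurableT_comp _ measurable_fst); exact: measurable_indic.
Qed.

Let kL2 n x : L2 nu (k n ^~ x).
Proof.
split; last exact: hE.
exact: (@cmeasurable_comp _ _ _ _ _ (fun p : Z * X => k n p.1 p.2)
  (fun z => (z, x)) (pair2_measurable x) (mk n)).
Qed.

Let kL2' n z : L2 mu (k n z). Proof. exact: L2Z. Qed.

Let kL2_prod n : L2 (nu \x mu)%E (fun p => k n p.1 p.2).
Proof. by split => //; rewrite sqnorm_tonelli1//; exact: hE2. Qed.

Lemma analysis_cover f z : analysis f z != 0 -> exists n, E n z.
Proof.
move=> fz; have [//|h0] := coverE z; exfalso; move/eqP : fz; apply.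
rewrite /analysis /cdot; under eq_cintegral do rewrite h0 rmorph0 mulr0.
exact: cintegral0.
Qed.

Section Fixed.
Variable f : X -> R[i].
Hypothesis fL2 : L2 mu f.

(** The adjoint of [analysis], cut to [E n] and applied to the coefficients of [f]. *)
Definition synthesis n (x : X) : R[i] :=
  cintegral nu setT (fun z => (\1_(E n) z)%:C * (analysis f z * h z x)).

Let synthesisE n x :
  synthesis n x = cintegral nu setT (fun z => analysis f z * k n z x).
Proof. by apply: eq_cintegral => z _; rewrite /k mulrCA. Qed.

Lemma synthesis_cintegrable n x :
  cintegrable nu setT (fun z => (\1_(E n) z)%:C * (analysis f z * h z x)).
Proof.
rewrite (_ : (fun z => _) = (fun z => analysis f z * k n z x)); last first.
  by apply/funext => z; rewrite /k mulrCA.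
by apply: L2_mul_cintegrable; [exact: L2_analysis|exact: kL2].
Qed.

(** Cauchy-Schwarz in z at each x bounds the square of the value by the squared norm of the
    coefficients times that of the truncated kernel; integrating in x leaves the kernel norm on the
    product. *)
Lemma L2_synthesis n : L2 mu (synthesis n).
Proof.
have lG := L2_analysis fL2.
have mS : cmeasurable (synthesis n).
  rewrite (_ : synthesis n = fun x =>
      cintegral nu setT (fun z => analysis f z * k n z x)); last first.
    by apply/funext => x; rewrite synthesisE.
  apply: (@cmeasurable_cintegral1 _ _ _ _ _ nu
    (fun p : Z * X => analysis f p.1 * k n p.1 p.2)).
  by apply: cmeasurableM => //; exact: cmeasurable_comp measurable_fst (L2_meas lG).
split=> //.
have ms : measurable_fun setT (fun x => sqnorm nu (k n ^~ x)).
  apply: (measurable_fun_fubini_tonelli_G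
    (fun p : Z * X => (normc (k n p.1 p.2) ^+ 2)%:E)).
    exact: measurable_sqr_normc.
  by move=> p; rewrite lee_fin sqr_ge0.
apply: (@le_lt_trans _ _ (\int[mu]_x (sqnorm nu (analysis f) * sqnorm nu (k n ^~ x)))%E).
  apply: ge0_le_integral => //.
  - by move=> x _; rewrite lee_fin sqr_ge0.
  - exact: measurable_sqr_normc.
  - exact: measurable_funeM.
  - move=> x _; have lk := kL2 n x; rewrite synthesisE.
    have := sqr_cdot_le lG (L2_conj lk).
    rewrite /cdot; under eq_cintegral do rewrite cconjK.
    rewrite -lee_fin => /le_trans; apply; rewrite EFinM (L2_fin lG) (L2_fin (L2_conj lk)).
    by rewrite (@eq_sqnorm _ _ _ _ (fun z => (k n z x)^*) (k n ^~ x))// => z;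
       rewrite normc_conj.
rewrite ge0_integralZl ?sqnorm_ge0//; last by move=> x _; exact: sqnorm_ge0.
rewrite -(sqnorm_tonelli2 _ _ (mk n)) -(L2_fin lG) lte_mul_pinfty ?lee_fin//.
  by rewrite fine_ge0 ?sqnorm_ge0.
by case: (kL2_prod n).
Qed.

(** Fubini. The integrand [F] is grouped as a tensor product of the coefficients and the conjugate
    of g, times the kernel: two square-integrable factors on the product, hence an integrable
    function. *)
Lemma cdot_synthesis n g : L2 mu g ->
  cdot mu (synthesis n) g =
  cdot nu (fun z => (\1_(E n) z)%:C * analysis f z) (analysis g).
Proof.
move=> lg; have lG := L2_analysis fL2; have lGg := L2_analysis lg.
pose F (p : Z * X) := (analysis f p.1 * (g p.2)^*) * k n p.1 p.2.
have iF : cintegrable (nu \x mu)%E setT F.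
  apply: L2_mul_cintegrable; last exact: kL2_prod.
  exact: (L2_tensor lG (L2_conj lg)).
have iF1 x : cintegrable nu setT (fun z => F (z, x)).
  apply: L2_mul_cintegrable; last exact: kL2.
  rewrite (_ : (fun z => _) = (fun z => (g x)^* * analysis f z)); first exact: L2Z.
  by apply/funext => z /=; rewrite mulrC.
have iF2 z : cintegrable mu setT (fun x => F (z, x)).
  apply: L2_mul_cintegrable; last exact: kL2'.
  exact: (L2Z (analysis f z) (L2_conj lg)).
transitivity (cintegral mu setT (fun x => cintegral nu setT (fun z => F (z, x)))).
  apply: eq_cintegral => x _; rewrite synthesisE mulrC -cintegralZ.
    by apply: eq_cintegral => z _; rewrite /F /= mulrA (mulrC (g x)^*).
  by apply: L2_mul_cintegrable => //; exact: kL2.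
rewrite -(cintegral_fubini iF iF2 iF1).
apply: eq_cintegral => z _; rewrite -(cdot_conj lg (hL2 z)) /cdot -cintegralZ.
  by apply: eq_cintegral => x _; rewrite /F /k /=; ring.
by apply: L2_cdot_cintegrable.
Qed.

Let rest n z : R[i] := (\1_(E n) z)%:C * analysis f z - analysis f z.

(* The error, tested against itself, only sees the part of the analysis
   outside [E n]. *)
Lemma synthesis_error n :
  (sqnorm mu (fun x => ((c%:C)^-1 * synthesis n x - f x)%R) <=
   (c^-1)%:E * sqnorm nu (rest n))%E.
Proof.
have lG := L2_analysis fL2; have lS := L2_synthesis n.
have lr : L2 nu (rest n) by apply: L2B => //; exact: L2_indicM.
set e := (fun x => _).
have lS' := L2Z (c%:C)^-1 lS.
have le : L2 mu e by exact: L2B.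
have h1 : cdot mu e e = (c%:C)^-1 * cdot nu (rest n) (analysis e).
  rewrite {1}/e (cdotBl lS' fL2 le) (cdotZl _ lS le) (cdot_synthesis n le).
  rewrite (cdotBl (L2_indicM (mE n) lG) lG (L2_analysis le)).
  by rewrite (cdot_analysis fL2 le) mulrBr (mulrA _ c%:C) real_complexVK mul1r.
have h2 := sqr_cdot_le lr (L2_analysis le).
have h3 : fine (sqnorm nu (analysis e)) = c * fine (sqnorm mu e).
  by rewrite isometry// -(L2_fin le).
have e0 : 0 <= fine (sqnorm mu e) by rewrite fine_ge0 ?sqnorm_ge0.
have r0 : 0 <= fine (sqnorm nu (rest n)) by rewrite fine_ge0 ?sqnorm_ge0.
rewrite -(L2_fin le) -(L2_fin lr) -EFinM lee_fin.
move/(congr1 (fun z => normc z ^+ 2)) : h1.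
rewrite (cdot_sqnorm le) normcM exprMn normcV !normc_real !ger0_norm ?(ltW c_gt0)// => h1.
rewrite h3 in h2.
move: h1 h2 e0 r0; move: (fine (sqnorm mu e)) (fine (sqnorm nu (rest n))) (normc _) => s r q.
(* With s the squared error and r the squared tail, s^2 <= c^-2 (r c s). Dividing by s needs s > 0;
   the case s = 0 is immediate. *)
move=> h1 h2; rewrite le_eqVlt => /orP[/eqP<- r0|s0 r0].
  by rewrite mulr_ge0// invr_ge0 ltW.
rewrite -(ler_pM2l s0) -expr2 h1.
have ci : 0 < c^-1 by rewrite invr_gt0.
apply: le_trans (ler_wpM2l (sqr_ge0 c^-1) h2) _.
rewrite le_eqVlt; apply/orP; left; apply/eqP; field.
by rewrite gt_eqF.
Qed.

Lemma synthesis_cvg (e : R) : 0 < e -> \forall n \near \oo,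
  (sqnorm mu (fun x => ((c%:C)^-1 * synthesis n x - f x)%R) < e%:E)%E.
Proof.
move=> e0; have := sqnorm_indicM_cvg mE ndE (@analysis_cover f) (L2_analysis fL2).
move=> /(_ _ (mulr_gt0 c_gt0 e0)); apply: filterS => n rn.
apply: le_lt_trans (synthesis_error n) _.
by rewrite lte_pdivrMl.
Qed.

(** Where the full integral converges absolutely, the truncated ones converge to it, so the
    pointwise error has a limit; since the error tends to 0 in L^2, that limit is 0 almost
    everywhere. *)
Lemma synthesis_ae : {ae mu, forall x,
  cintegrable nu setT (fun z => analysis f z * h z x) ->
  f x = (c%:C)^-1 * cintegral nu setT (fun z => analysis f z * h z x)}.
Proof.
have ms n : cmeasurable (fun x => (c%:C)^-1 * synthesis n x - f x).
  by apply: cmeasurableB; [exact: L2_meas (L2Z _ (L2_synthesis n))|exact: L2_meas fL2].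
have := sqnorm_cvg0_ae ms synthesis_cvg.
apply: filterS => x xP ix.
set I := cintegral _ _ _.
have coverx z : analysis f z * h z x != 0 -> exists n, E n z.
  move=> fh; apply: (@analysis_cover f); apply: contra_neq fh => ->.
  by rewrite mul0r.
have cI := cintegral_indicM_cvg mE ndE coverx ix.
suff /eqP : normc ((c%:C)^-1 * I - f x) = 0.
  by rewrite normc_eq0 subr_eq0 => /eqP.
apply: xP; apply/cvgrPdist_le => e e0.
move/cvgr0Pnorm_le : cI => /(_ _ (mulr_gt0 c_gt0 e0)); apply: filterS => n.
rewrite ger0_norm ?normc_ge0// => In.
have {}In : normc ((c%:C)^-1 * (synthesis n x - I)) <= e.
  by rewrite normcM normcV normc_real gtr0_norm// ler_pdivrMl.
set a := (c%:C)^-1 * I - f x; set b := _ * synthesis n x - f x.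
have ab : b - a = (c%:C)^-1 * (synthesis n x - I) by rewrite /a /b; ring.
rewrite -ab in In.
have h1 := le_normcD (b - a) a; rewrite subrK in h1.
have h2 := le_normcD (a - b) b; rewrite subrK -opprB normcN in h2.
by rewrite ler_norml; apply/andP; split; lra.
Qed.

End Fixed.
End Resolution.

(** * Local fields *)

(** Induction on compact sets. If [P C] failed, the sets whose complement in C satisfies [P] would
    form a proper filter containing C, and its cluster point would contradict the local
    hypothesis. *)
Lemma compact_ideal {T : topologicalType} (P : set T -> Prop) (C : set T) :
  P set0 -> (forall A B, A `<=` B -> P B -> P A) ->
  (forall A B, P A -> P B -> P (A `|` B)) ->
  (forall x, C x -> exists2 B, nbhs x B & P B) ->
  compact C -> P C.
Proof.
move=> P0 Psub PU Ploc cC; apply: contrapT => nPC.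
pose F := [set A | P (C `\` A)].
have FF : ProperFilter F.
  apply: Build_ProperFilter_ex.
    move=> A FA; apply: contrapT => A0; apply: nPC; apply: Psub FA.
    by move=> x Cx; split=> // Ax; apply: A0; exists x.
  split.
  - by rewrite /F /= setDT.
  - by move=> A B FA FB; rewrite /F /= setDIr; exact: PU.
  - by move=> A B AB; apply: Psub; exact: setDS.
have FC : F C by rewrite /F /= setDv.
have [p [Cp clFp]] := cC F FF FC.
have [B pB PB] := Ploc p Cp.
have FB : F (~` B) by apply: Psub PB => x [_ /contrapT].
by have [x []] := clFp (~` B) B FB pB.
Qed.

Lemma unif_continuous_continuous {U V : uniformType} (f : U -> V) :
  unif_continuous f -> continuous f.
Proof.
move=> uf x A /nbhsP[E entE EA]; apply/nbhsP.
exists ((fun xy => (f xy.1, f xy.2)) @^-1` E); first exact: uf.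
by move=> y /xsectionP /= Ey; apply: EA; apply/xsectionP.
Qed.

(** * Topology of a local field *)

Section LocalFieldTopology.
Context {K : localFieldType}.
Implicit Types (x y a : K) (U V C : set K).

Lemma local_add_continuous : continuous (fun z : K * K => z.1 + z.2).
Proof. exact/unif_continuous_continuous/add_unif_continuous. Qed.

Lemma local_sub_continuous : continuous (fun z : K * K => z.1 - z.2).
Proof. exact/unif_continuous_continuous/sub_unif_continuous. Qed.

Lemma addl_continuous x : continuous (fun y => x + y).
Proof.
move=> y; apply: (@continuous_comp _ _ _ (fun y : K => (x, y))
  (fun z : K * K => z.1 + z.2)); last exact: local_add_continuous.
by apply: cvg_pair => /=; [exact: cvg_cst|exact: cvg_id].
Qed.

Lemma mull_continuous a : continuous (fun y => a * y).
Proof.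
move=> y; apply: (@continuous_comp _ _ _ (fun y : K => (a, y))
  (fun z : K * K => z.1 * z.2)); last exact: local_mul_continuous.
by apply: cvg_pair => /=; [exact: cvg_cst|exact: cvg_id].
Qed.

Lemma nbhs_addl x U : nbhs 0 (fun y => U (x + y)) -> nbhs x U.
Proof.
move=> U0; have := @addl_continuous (- x) x (fun y => U (x + y)).
rewrite /= addNr => /(_ U0) h.
suff -> : U = (fun y => - x + y) @^-1` (fun y => U (x + y)) by [].
by apply/funext => y /=; rewrite addrA subrr add0r.
Qed.

Lemma nbhs_addl0 x U : nbhs x U -> nbhs 0 (fun y => U (x + y)).
Proof.
move=> Ux; have := @addl_continuous x 0 U; rewrite addr0 => /(_ Ux).
exact.
Qed.

(** In a uniform space, two points without disjoint neighbourhoods share every entourage, so one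
    lies in the closure of the other. That closure is connected, and total disconnectedness makes
    the points equal. *)
Lemma local_hausdorff : hausdorff_space K.
Proof.
move=> x y; rewrite -closeEnbhs entourage_close => xy.
have cly : closure [set x] y.
  move=> B /nbhsP[E1 entE1 sE1B]; exists x; split => //; apply: sE1B.
  by apply/xsectionP; exact: (xy _ (entourage_inv entE1)).
have := local_totally_disconnected (s := K) x I => h.
have : connected_component [set: K] x y.
  apply: (@connected_component_max _ _ (closure [set x])) => //.
    exact: subset_closure.
  exact/connected_closure/connected1.
by rewrite h => ->.
Qed.

(** If {0} were a neighbourhood of 0, every set would be open by translation, against
    nondiscreteness. *)
Lemma nbhs0_neq0 U : nbhs 0 U -> exists2 x, U x & x != 0.
Proof.
move=> U0; apply: contrapT => h; apply: (@local_nondiscrete K) => A.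
rewrite openE => x Ax; apply: nbhs_addl; apply: filterS U0 => y Uy /=.
suff -> : y = 0 by rewrite addr0.
by apply: contrapT => /eqP y0; apply: h; exists y.
Qed.

Lemma nbhs_neq0 x : x != 0 -> \forall y \near x, y != 0.
Proof.
move=> x0; have := hausdorff_accessible local_hausdorff x0.
move=> [A [oA /set_mem xA /set_mem A0]]; apply: filterS (open_nbhs_nbhs (conj oA xA)).
by move=> y Ay; apply/eqP => y0; apply: A0; rewrite -y0.
Qed.

Lemma compact_nbhs : exists V, [/\ nbhs (0 : K) V, compact V & closed V].
Proof.
have := @local_locally_compact K 0 I => -[V + [cV clV]].
by rewrite withinET => V0; exists V.
Qed.

(** Tube lemma: multiplication is continuous at each (0, v), and compactness of V makes the
    neighbourhood of 0 uniform in v. *)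
Lemma nbhs0_mul_compact V U : compact V -> nbhs 0 U ->
  \forall a \near (0 : K), forall v, V v -> U (a * v).
Proof.
move=> /compact_near_coveringP cV U0.
apply: (cV _ (nbhs (0 : K)) (fun a v => U (a * v))) => x Vx.
have := @local_mul_continuous K (0, x) U; rewrite /= mul0r => /(_ U0).
move=> [[A B] /= [A0 Bx] AB]; exists (B, A) => //= -[u v] /= [Bu Av].
exact: (AB (v, u)).
Qed.

Lemma nbhs_mull a x U : a != 0 -> nbhs x U -> nbhs (a * x) (fun y => U (a^-1 * y)).
Proof.
move=> a0 Ux; have := @mull_continuous a^-1 (a * x) U.
by rewrite mulrA mulVf// mul1r => /(_ Ux).
Qed.

Lemma image_mull a C : a != 0 -> [set a * x | x in C] = [set y | C (a^-1 * y)].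
Proof.
move=> a0; apply/seteqP; split=> [_ [x Cx <-]|y Cy] /=.
  by rewrite mulrA mulVf// mul1r.
by exists (a^-1 * y) => //; rewrite mulrA mulfV// mul1r.
Qed.

Lemma image_addl a C : [set a + x | x in C] = [set y | C (y - a)].
Proof.
apply/seteqP; split=> [_ [x Cx <-]|y Cy] /=; first by rewrite addrC addKr.
by exists (y - a) => //; rewrite addrC subrK.
Qed.

Lemma compact_mull a C : compact C -> compact [set a * x | x in C].
Proof.
move=> cC; apply: continuous_compact => //; apply: continuous_subspaceT.
exact: mull_continuous.
Qed.

End LocalFieldTopology.

(** * Borel sets of a local field *)

Section BorelSets.
Context {K : localFieldType}.
Implicit Types (U C : set K).

Lemma borel_open U : open U -> measurable (U : set (borel K)).
Proof. by move=> oU; apply: sub_sigma_algebra. Qed.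

Lemma borel_closed C : closed C -> measurable (C : set (borel K)).
Proof.
move=> cC; rewrite -[C]setCK; apply: measurableC; apply: borel_open.
exact: closed_openC.
Qed.

Lemma borel_compact C : compact C -> measurable (C : set (borel K)).
Proof. by move=> cC; apply: borel_closed; exact: compact_closed local_hausdorff cC. Qed.

Lemma borel_set1 (x : K) : measurable ([set x] : set (borel K)).
Proof. by apply: borel_compact; exact: compact_set1. Qed.

Lemma continuous_borel_measurable (f : K -> K) :
  continuous f -> measurable_fun setT (f : borel K -> borel K).
Proof.
move=> cf; apply: (@measurability _ _ (borel K) (borel K) setT f (@open K)) => //.
by move=> _ [B oB <-]; rewrite setTI; apply: borel_open; exact: open_comp.
Qed.

Lemma borel_image_mull (a : K) (A : set K) : a != 0 ->
  measurable (A : set (borel K)) ->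
  measurable ([set a * x | x in A] : set (borel K)).
Proof.
move=> a0 mA; rewrite image_mull//.
have := continuous_borel_measurable (@mull_continuous K a^-1).
by move=> /(_ measurableT _ mA); rewrite setTI.
Qed.

Lemma borel_image_addl (a : K) (A : set K) : measurable (A : set (borel K)) ->
  measurable ([set a + x | x in A] : set (borel K)).
Proof.
move=> mA; rewrite image_addl.
have := continuous_borel_measurable (@addl_continuous K (- a)).
move=> /(_ measurableT _ mA); rewrite setTI.
rewrite (_ : [set y | _] = (fun y => - a + y) @^-1` A)//.
by apply/funext => y /=; rewrite addrC.
Qed.

End BorelSets.

(** * The modulus defined by a Haar measure *)

Section HaarModulus.
Context {R : realType} {K : localFieldType}.
Variables (mu : {measure set (borel K) -> \bar R}) (abs : K -> R).
Hypothesis mu_haar : is_haar mu.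
Hypothesis abs_modulus : is_haar_modulus mu abs.

Let haar_add x (A : set K) : measurable (A : set (borel K)) ->
  mu [set x + y | y in A] = mu A.
Proof. by case: mu_haar => _ h _ _ _; exact: h. Qed.

Let haar_compact (C : set K) : compact C -> (mu C < +oo)%E.
Proof. by case: mu_haar => _ _ h _ _; exact: h. Qed.

Let haar_outer (A : set K) (e : \bar R) : measurable (A : set (borel K)) ->
  (mu A < e)%E -> exists U : set K, [/\ open U, A `<=` U & (mu U < e)%E].
Proof.
move=> mA Ae; case: mu_haar => _ _ _ /(_ A mA) h _.
move: Ae; rewrite h => /ereal_inf_lt[_ [U [oU AU] <-] Ue].
by exists U.
Qed.

Lemma haar_null_compact (C : set K) :
  (forall x, C x -> exists2 U : set K, nbhs x U &
     measurable (U : set (borel K)) /\ mu U = 0%E) ->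
  compact C -> mu C = 0%E.
Proof.
move=> loc cC.
have : mu.-negligible (C : set (borel K)).
  apply: (@compact_ideal K (fun A => mu.-negligible (A : set (borel K)))) => //.
  - exact: negligible_set0.
  - by move=> A B AB; exact: negligibleS.
  - by move=> A B nA nB; exact: negligibleU.
  - move=> x /loc[U xU [mU U0]]; exists U => //.
    exact/negligibleP.
by move/negligibleP; apply; exact: borel_compact.
Qed.

(** If V were null, its translates would make every compact set null, and inner regularity of the
    whole space would give the zero measure. *)
Lemma haar_nbhs_gt0 (V : set K) : nbhs 0 V ->
  measurable (V : set (borel K)) -> (0 < mu V)%E.
Proof.
move=> V0 mV; rewrite lt0e measure_ge0 andbT; apply/eqP => muV0.
have C0 (C : set K) : compact C -> mu C = 0%E.
  apply: haar_null_compact => x _; exists [set x + y | y in V].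
    apply: nbhs_addl; apply: filterS V0 => y Vy /=; by exists y.
  by split; [exact: borel_image_addl|rewrite haar_add].
case: mu_haar => /eqP + _ _ _ /(_ setT openT) h; apply; rewrite h.
apply/eqP; rewrite eq_le; apply/andP; split.
  by apply: ub_ereal_sup => _ [C [cC _] <-]; rewrite C0.
by apply: ereal_sup_ubound; exists set0; [split; [exact: compact0|]|exact: measure0].
Qed.

(** If {0} had mass m > 0, finite since a point is compact, outer regularity would give an open set
    around 0 of mass below 2 m. It contains a second point by nondiscreteness, also of mass m by
    translation. *)
Lemma haar_set10 : mu [set (0%R : K)] = 0%E.
Proof.
apply/eqP; rewrite -measure_le0 leNgt; apply/negP => m0.
have fin0 : (mu [set (0%R : K)] < +oo)%E.
  by apply: haar_compact; exact: compact_set1.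
have m0f : mu [set (0%R : K)] \is a fin_num.
  by rewrite ge0_fin_numE ?measure_ge0.
have [U [oU U0 U2]] : exists U : set K, [/\ open U, [set 0] `<=` U &
    (mu U < mu [set (0%R : K)] + mu [set (0%R : K)])%E].
  by apply: haar_outer; [exact: borel_set1|rewrite lteDl].
have U00 : nbhs (0 : K) U by apply: open_nbhs_nbhs; split => //; exact: U0.
have [x Ux x0] := nbhs0_neq0 U00.
move: U2; rewrite ltNge => /negP; apply.
have mx : mu [set (x : K)] = mu [set (0%R : K)].
  by rewrite -(haar_add x (borel_set1 0)) image_set1 addr0.
rewrite -[X in (_ + X)%E]mx -measureU//; [|exact: borel_set1|exact: borel_set1|].
  apply: le_measure; rewrite ?inE.
  - by apply: measurableU; exact: borel_set1.
  - exact: borel_open.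
  - by move=> y [->|->//]; exact: U0.
by apply/seteqP; split => // y [/= ->] /eqP; rewrite eq_sym (negPf x0).
Qed.

(** A reference set of positive finite measure: [abs a] is the ratio of the measures of a V0 and V0,
    from which the properties of the modulus are read off. *)
Let V0 := xget set0 [set V : set K | [/\ nbhs (0 : K) V, compact V & closed V]].

Let V0P : [/\ nbhs (0 : K) V0, compact V0 & closed V0].
Proof.
exact: (xgetPex set0 (@compact_nbhs K)).
Qed.

Let mV0 : measurable (V0 : set (borel K)).
Proof. by apply: borel_closed; case: V0P. Qed.

Let v := fine (mu V0).

Let vE : mu V0 = v%:E.
Proof.
rewrite /v fineK// ge0_fin_numE ?measure_ge0//; apply: haar_compact.
by case: V0P.
Qed.

Let v_gt0 : 0 < v.
Proof. by rewrite -lte_fin -vE; apply: haar_nbhs_gt0 => //; case: V0P. Qed.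

Let absE (a : K) : a != 0 -> mu [set a * x | x in V0] = (abs a * v)%:E.
Proof. by move=> a0; case: abs_modulus => _ ->//; rewrite vE EFinM. Qed.

Lemma modulus0 : abs 0 = 0. Proof. by case: abs_modulus. Qed.

Lemma modulus_ge0 a : 0 <= abs a.
Proof.
have [->|a0] := eqVneq a 0; first by rewrite modulus0.
by rewrite -(pmulr_lge0 _ v_gt0) -lee_fin -absE// measure_ge0.
Qed.

Lemma modulus1 : abs 1 = 1.
Proof.
apply: (mulIf (lt0r_neq0 v_gt0)); apply: EFin_inj; rewrite -absE ?oner_neq0//.
by rewrite mul1r -vE; congr (mu _); apply/seteqP; split=> [_ [x Vx <-]|x Vx];
  [rewrite mul1r|exists x => //; rewrite mul1r].
Qed.

Lemma modulusM a b : abs (a * b) = abs a * abs b.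
Proof.
have [->|a0] := eqVneq a 0; first by rewrite mul0r modulus0 mul0r.
have [->|b0] := eqVneq b 0; first by rewrite mulr0 modulus0 mulr0.
have ab0 : a * b != 0 by rewrite mulf_neq0.
apply: (mulIf (lt0r_neq0 v_gt0)); apply: EFin_inj; rewrite -absE//.
rewrite (_ : [set _ | x in V0] = [set a * x | x in [set b * y | y in V0]]); last first.
  rewrite image_comp; congr (image _ _); apply/funext => x /=.
  by rewrite mulrA.
case: abs_modulus => _ ->//; last exact: borel_image_mull.
by rewrite absE// -EFinM mulrA.
Qed.

Lemma modulus_gt0 a : a != 0 -> 0 < abs a.
Proof.
move=> a0; rewrite lt_def modulus_ge0 andbT; apply/eqP => aa.
have := modulus1; rewrite -(mulfV a0) modulusM aa mul0r => /eqP.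
by rewrite eq_sym oner_eq0.
Qed.

Lemma modulusV a : abs a^-1 = (abs a)^-1.
Proof.
have [->|a0] := eqVneq a 0; first by rewrite invr0 modulus0 invr0.
apply: (mulIf (lt0r_neq0 (modulus_gt0 a0))).
by rewrite -modulusM mulVf// modulus1 mulVf// lt0r_neq0// modulus_gt0.
Qed.

Lemma modulusX a n : abs (a ^+ n) = abs a ^+ n.
Proof. by elim: n => [|n ih]; rewrite ?modulus1// !exprS modulusM ih. Qed.

Lemma modulus_eq0 a : (abs a == 0) = (a == 0).
Proof.
have [->|a0] := eqVneq a 0; first by rewrite modulus0 eqxx.
by rewrite gt_eqF// modulus_gt0.
Qed.

(** As {0} is null, there are open sets around 0 of arbitrarily small measure, and a V0 fits into
    such a set once a is close to 0. *)
Lemma modulus_near0 (e : R) : 0 < e -> \forall a \near (0 : K), abs a <= e.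
Proof.
move=> e0; have [V00 cV _] := V0P.
have [U [oU U0 Ue]] : exists U : set K, [/\ open U, [set 0] `<=` U &
    (mu U < (e * v)%:E)%E].
  by apply: haar_outer; [exact: borel_set1|rewrite haar_set10 lte_fin mulr_gt0].
have U00 : nbhs (0 : K) U by apply: open_nbhs_nbhs; split => //; exact: U0.
have := nbhs0_mul_compact cV U00; apply: filterS => a aVU.
have [->|a0] := eqVneq a 0; first by rewrite modulus0 ltW.
rewrite -(ler_pM2r v_gt0) -lee_fin -absE//; apply: le_trans (ltW Ue).
apply: le_measure; rewrite ?inE.
- exact: borel_image_mull.
- exact: borel_open.
- by move=> _ [x Vx <-]; exact: aVU.
Qed.

(** A nonzero w near 0 carries C into the set where the modulus is at most 1, so |w|^-1 is a
    bound. *)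
Lemma modulus_compact (C : set K) : compact C ->
  exists2 M : R, 0 < M & forall x, C x -> abs x <= M.
Proof.
move=> cC; have := nbhs0_mul_compact cC (modulus_near0 ltr01).
move=> /nbhs0_neq0[w wC w0]; exists (abs w)^-1; first by rewrite invr_gt0 modulus_gt0.
move=> x /wC; rewrite modulusM => h.
by rewrite -(ler_pM2l (modulus_gt0 w0)) mulfV ?lt0r_neq0 ?modulus_gt0.
Qed.

(** Inversion sends a neighbourhood of y into a compact neighbourhood of y^-1, where the modulus is
    bounded above. *)
Lemma modulus_near_gt0 (y : K) : y != 0 ->
  exists2 m : R, 0 < m & \forall x \near y, m <= abs x.
Proof.
move=> y0; have [V00 cV _] := V0P.
have cC : compact [set y^-1 + x | x in V0].
  apply: continuous_compact cV; apply: continuous_subspaceT; exact: addl_continuous.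
have [M M0 CM] := modulus_compact cC.
exists M^-1; first by rewrite invr_gt0.
have Cy : nbhs y^-1 [set y^-1 + x | x in V0].
  by apply: nbhs_addl; apply: filterS V00 => x Vx /=; exists x.
have Cy' : \forall x \near y, [set y^-1 + x | x in V0] x^-1.
  exact: (local_inv_continuous y y0 _ Cy).
near=> x.
have x0 : x != 0 by near: x; exact: nbhs_neq0.
have Cx : [set y^-1 + x | x in V0] x^-1 by near: x.
have := CM _ Cx; rewrite modulusV => h.
by rewrite -[leRHS]invrK lef_pV2// posrE ?invr_gt0 ?modulus_gt0.
Unshelve. all: by end_near. Qed.

End HaarModulus.

(** * Powers of a contracting element *)

Section Contraction.
Context {R : realType} {K : localFieldType}.
Variables (mu : {measure set (borel K) -> \bar R}) (abs : K -> R).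
Hypothesis mu_haar : is_haar mu.
Hypothesis abs_modulus : is_haar_modulus mu abs.

(* The sets p^n V form a neighbourhood basis at 0 and the sets p^-n V exhaust K. *)
Lemma exists_contraction : exists (V : set K) (p : K),
  [/\ nbhs 0 V, compact V, V p & p != 0] /\
  abs p < 1 /\ forall v, V v -> V (p * v).
Proof.
have [V [V0 cV _]] := @compact_nbhs K.
have h2 : 0 < 2^-1 :> R by rewrite invr_gt0.
have [p [Vp [pV ap]] p0] := nbhs0_neq0 (filterI V0 (filterI
  (nbhs0_mul_compact cV V0) (modulus_near0 mu_haar abs_modulus h2))).
exists V, p; split=> //; split=> //.
by apply: le_lt_trans ap _; rewrite invf_lt1// ltr1n.
Qed.

Variables (V : set K) (p : K).
Hypotheses (V0 : nbhs 0 V) (cV : compact V) (Vp : V p) (p0 : p != 0)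
  (p1 : abs p < 1) (pV : forall v, V v -> V (p * v)).

Let abs_ge0 a : 0 <= abs a. Proof. exact: (modulus_ge0 mu_haar abs_modulus). Qed.
Let absM a b : abs (a * b) = abs a * abs b.
Proof. exact: (modulusM mu_haar abs_modulus). Qed.
Let absX a n : abs (a ^+ n) = abs a ^+ n.
Proof. exact: (modulusX mu_haar abs_modulus). Qed.

Lemma contraction_pow_small (e : R) : 0 < e ->
  \forall n \near \oo, abs (p ^+ n) < e.
Proof.
move=> e0; have : abs p ^+ n @[n --> \oo] --> (0 : R).
  by apply: cvg_expr; rewrite ger0_norm.
move/cvgr0Pnorm_lt => /(_ _ e0); apply: filterS => n.
by rewrite absX ger0_norm// exprn_ge0.
Qed.

Lemma contraction_pow_mem v n : V v -> V (p ^+ n * v).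
Proof.
move=> Vv; elim: n => [|n ih]; first by rewrite mul1r.
by rewrite exprS -mulrA; exact: pV.
Qed.

(** The powers stay in a compact set, and only 0 can be a cluster point: their modulus tends to 0,
    while the modulus is bounded below near any nonzero point. *)
Lemma contraction_pow_cvg : p ^+ n @[n --> \oo] --> (0 : K).
Proof.
have VF : \forall n \near \oo, V (p ^+ n).
  (* V need not contain 1; the powers lie in it from exponent 1 on, because p does. *)
  by exists 1%N => // -[//|n] _ /=; rewrite exprSr; exact: contraction_pow_mem.
have cl0 y : cluster (p ^+ n @[n --> \oo]) y -> y = 0.
  move=> cly; apply: contrapT => /eqP y0.
  have [m m0 mP] := modulus_near_gt0 mu_haar abs_modulus y0.
  have := cly [set x | abs x < m] _ (contraction_pow_small m0) mP.
  by move=> [x [/= xm mx]]; move: (lt_le_trans xm mx); rewrite ltxx.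
apply: (compact_cluster_set1 local_hausdorff cV V0 _ VF).
apply/seteqP; split=> [y /cl0 -> //|_ ->].
have [y [_ cly]] := cV (fmap_proper_filter _ _) VF.
by rewrite -(cl0 y cly).
Qed.

Lemma contraction_pow_nbhs (U : set K) : nbhs 0 U ->
  exists n, forall v, V v -> U (p ^+ n * v).
Proof.
move=> U0; have := contraction_pow_cvg (nbhs0_mul_compact cV U0).
by move=> [N _ h]; exists N; exact: (h N (leqnn N)).
Qed.

(** On the shell of V outside p V: near 0 the premise fails, near any other point the modulus is
    bounded below, and compactness of V gives a common bound. *)
Let lower_bound : exists2 e : R, 0 < e &
  forall z, V z -> ~ V (p^-1 * z) -> e <= abs z.
Proof.
have /compact_near_coveringP h := cV.
have := h _ (0 : R)^'+ (fun e z => ~ V (p^-1 * z) -> e <= abs z) _.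
case.
  move=> x Vx; have [->|x0] := eqVneq x 0.
    have pV0 : nbhs (0 : K) (fun y => V (p^-1 * y)).
      by have := nbhs_mull p0 V0; rewrite mulr0.
    exists ([set y | V (p^-1 * y)], setT); first by split => //; exact: filterT.
    by move=> [y e] [/= Vy _] /(_ Vy).
  have [m m0 mP] := modulus_near_gt0 mu_haar abs_modulus x0.
  exists ([set y | m <= abs y], [set e | e <= m]).
    by split => //=; exact: nbhs_right_le.
  by move=> [y e] [/= my em] _; exact: le_trans my.
move=> d /= d0 dP; exists (d / 2); first by rewrite divr_gt0.
apply: (dP (d / 2)); last by rewrite divr_gt0.
by rewrite /ball_ /= sub0r normrN ger0_norm ?divr_ge0 ?ltW// gtr_pMr// invf_lt1// ltr1n.
Qed.

(** If n > 0 is least with p^n x in V, then p^n x lies in the shell of [lower_bound], so |p^n| |x|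
    >= e. For |x| <= r this fails once |p^n| is small, which bounds n in terms of r only. *)
Lemma closed_ball_absorbed (r : R) :
  exists n, forall x, abs x <= r -> V (p ^+ n * x).
Proof.
have [e e0 eP] := lower_bound.
(* r may be 0 or negative, hence the divisor |r| + 1. *)
have er : 0 < e / (`|r| + 1) by rewrite divr_gt0// ltr_wpDl.
have [N _ NP] := contraction_pow_small er.
exists N => x xr.
have exn : exists n, `[< V (p ^+ n * x) >].
  have [n nP] := contraction_pow_cvg (nbhs0_mul_compact (@compact_set1 K x) V0).
  by move=> nP'; exists n; apply/asboolP; exact: (nP' n (leqnn n)).
case: (ex_minnP exn) => n /asboolP Vn nmin.
suff nN : (n <= N)%N by rewrite -(subnK nN) exprD -mulrA; exact: contraction_pow_mem.
case: n Vn nmin => // n Vn nmin; rewrite leqNgt; apply/negP => Nn.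
have nV : ~ V (p^-1 * (p ^+ n.+1 * x)).
  rewrite exprS !mulrA mulVf// mul1r => Vn'.
  by have := nmin n (asboolT Vn'); rewrite ltnn.
have := eP _ Vn nV; rewrite leNgt => /negP; apply.
have := NP n.+1 (ltnW Nn); rewrite /= absM => h.
apply: le_lt_trans (ler_wpM2l (abs_ge0 (p ^+ n.+1)) (le_trans xr (ler_norm r))) _.
apply: (@le_lt_trans _ _ (abs (p ^+ n.+1) * (`|r| + 1))).
  by rewrite ler_wpM2l// lerDl.
by rewrite -ltr_pdivlMr// ltr_wpDl.
Qed.

End Contraction.

Lemma measurable_bigcup_countable {d} {T : measurableType d} {I : Type}
    (S : set I) (F : I -> set T) :
  countable S -> (forall i, S i -> measurable (F i)) ->
  measurable (\bigcup_(i in S) F i).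
Proof.
move=> /countable_injP[f injf] mF.
rewrite (_ : \bigcup_(i in S) F i =
    \bigcup_n \bigcup_(i in [set i | S i /\ f i = n]) F i); last first.
  apply/seteqP; split=> [x [i Si Fx]|x [n _ [i [Si _] Fx]]]; last by exists i.
  by exists (f i) => //; exists i.
apply: bigcupT_measurable => n.
have [[i [Si fi]]|noi] := pselect (exists i, S i /\ f i = n).
  rewrite (_ : \bigcup_(j in _) F j = F i); first exact: mF.
  apply/seteqP; split=> [x [j [Sj fj] Fx]|x Fx]; last by exists i.
  by rewrite -(injf j i) ?inE// fj fi.
rewrite (_ : \bigcup_(j in _) F j = set0)//.
by apply/seteqP; split => // x [j Sj _]; apply: noi; exists j.
Qed.

(** * Second countability and measurability of the field operations *)

Section SecondCountable.
Context {R : realType} {K : localFieldType}.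
Variables (mu : {measure set (borel K) -> \bar R}) (abs : K -> R).
Hypothesis mu_haar : is_haar mu.
Hypothesis abs_modulus : is_haar_modulus mu abs.

(** Having a countable net passes to subsets and finite unions, so every compact set has one by
    [compact_ideal]; the field is the countable union of the compact sets p^-n V. *)
Lemma countable_net (W : set K) : nbhs 0 W ->
  exists2 D : set K, countable D & forall x, exists2 d, D d & W (x - d).
Proof.
move=> W0.
have [V [p [[V0 cV Vp p0] [p1 pV]]]] := exists_contraction mu_haar abs_modulus.
pose P (A : set K) := exists2 D : set K, countable D &
  forall x, A x -> exists2 d, D d & W (x - d).
have PC (C : set K) : compact C -> P C.
  apply: compact_ideal.
  - by exists set0; [exact: countable0|].
  - by move=> A B AB [D cD DB]; exists D => // x /AB; exact: DB.
  - move=> A B [D cD DA] [D' cD' DB]; exists (\bigcup_b (if b then D else D')).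
      by apply: bigcup_countable => // -[].
    by move=> x [/DA[d Dd Wd]|/DB[d Dd Wd]]; exists d => //; [exists true|exists false].
  - move=> x _; exists [set y | W (y - x)].
      by apply: nbhs_addl; apply: filterS W0 => y Wy /=; rewrite addrAC subrr add0r.
    by exists [set x]; [exact: countable1|move=> y Wy; exists x].
have PN n : P [set (p ^+ n)^-1 * v | v in V] by apply: PC; exact: compact_mull.
have /choice[D DP] : forall n, exists D : set K, countable D /\
    forall x, [set (p ^+ n)^-1 * v | v in V] x -> exists2 d, D d & W (x - d).
  by move=> n; have [D cD DW] := PN n; exists D.
exists (\bigcup_n D n).
  by apply: bigcup_countable => // n _; have [] := DP n.
move=> x; have [n nP] := closed_ball_absorbed mu_haar abs_modulus V0 cV Vp p0 p1 pV (abs x).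
have [_ /(_ x)] := DP n.
case; first by exists (p ^+ n * x); [exact: nP|rewrite mulrA mulVf ?mul1r// expf_neq0].
by move=> d Dd Wd; exists d => //; exists n.
Qed.

(** [W n] is p^n times the interior of V. A basic set is a translate of [W n] by a point of a
    countable net for [W n], and p^n V is eventually inside any neighbourhood of 0. *)
Lemma countable_basis : exists B : set (set K), [/\ countable B,
  forall b, B b -> open b &
  forall x (U : set K), nbhs x U -> exists b, [/\ B b, b x & b `<=` U]].
Proof.
have [V [p [[V0 cV Vp p0] [p1 pV]]]] := exists_contraction mu_haar abs_modulus.
have pn0 n : p ^+ n != 0 by rewrite expf_neq0.
pose W n : set K := [set y | V^° ((p ^+ n)^-1 * y)].
have W0 n : nbhs 0 (W n).
  have V00 : nbhs (0 : K) V^° by apply/nbhs_interior.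
  by have := nbhs_mull (pn0 n) V00; rewrite mulr0.
have oW n d : open [set y | W n (y - d)].
  have oV : open V^° by exact: open_interior.
  have c1 : continuous (fun y : K => y - d).
    rewrite (_ : (fun y : K => y - d) = (fun y => - d + y)); first exact: addl_continuous.
    by apply/funext => y; rewrite addrC.
  have -> : [set y | W n (y - d)] =
    (fun y => y - d) @^-1` ((fun y => (p ^+ n)^-1 * y) @^-1` V^°) by [].
  apply: open_comp; first by move=> x _; exact: c1.
  by apply: open_comp => // x _; exact: mull_continuous.
have /choice[D DP] : forall n, exists D : set K, countable D /\
    forall x, exists2 d, D d & W n (x - d).
  by move=> n; have [D cD DW] := countable_net (W0 n); exists D.
exists (\bigcup_n [set [set y | W n (y - d)] | d in D n]); split.
- apply: bigcup_countable => // n _.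
  by apply: sub_countable (DP n).1; exact: card_image_le.
- by move=> _ [n _ [d _ <-]].
- move=> x U xU.
  (* Here x + (s - t) lies in U for s in A1 and t in A2; the choice s = y - d, t = x - d gives y. *)
  have := @local_sub_continuous K (0, 0) _ (_ : nbhs _ (fun y => U (x + y))).
  rewrite /= subrr => /(_ (nbhs_addl0 xU)) [[A1 A2] /= [A10 A20] A12].
  have [n nP] := contraction_pow_nbhs mu_haar abs_modulus V0 cV Vp p1 pV (filterI A10 A20).
  have [_ /(_ x)[d Dd Wd]] := DP n.
  exists [set y | W n (y - d)]; split => //; first by exists n => //; exists d.
  move=> y Wy.
  have /nP[Ax _] : V ((p ^+ n)^-1 * (y - d)) by exact: interior_subset Wy.
  have /nP[_ Ad] : V ((p ^+ n)^-1 * (x - d)) by exact: interior_subset Wd.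
  rewrite mulrA mulfV ?mul1r// in Ax; rewrite mulrA mulfV ?mul1r// in Ad.
  have /= := A12 (y - d, x - d) (conj Ax Ad).
  by rewrite (_ : x + _ = y)//; ring.
Qed.

(** The countable basis makes an open set of the product a countable union of open rectangles, which
    places it in the product sigma-algebra. *)
Lemma open_prod_measurable (O : set (K * K)) : open O ->
  measurable (O : set (borel K * borel K)%type).
Proof.
move=> oO; have [B [cB oB bB]] := countable_basis.
have -> : O = \bigcup_(q in [set q : set K * set K |
    [/\ B q.1, B q.2 & q.1 `*` q.2 `<=` O]]) (q.1 `*` q.2).
  apply/seteqP; split=> [[x y] Oxy|z [q [_ _ qO]]]; last exact: qO.
  have [[A1 A2] /= [A1x A2y] AO] : nbhs (x, y) O by exact: open_nbhs_nbhs.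
  have [b1 [Bb1 b1x bA1]] := bB _ _ A1x.
  have [b2 [Bb2 b2y bA2]] := bB _ _ A2y.
  exists (b1, b2) => //=; split => //.
  by move=> z [/bA1 z1 /bA2 z2]; exact: AO.
apply: measurable_bigcup_countable.
  apply: (@sub_countable _ _ _ (B `*` B)); last exact: countableX.
  by apply: subset_card_le => q [Bq1 Bq2 _]; split.
by move=> q [B1 B2 _]; apply: measurableX; apply: borel_open; exact: oB.
Qed.

Lemma continuous_prod_measurable (f : K * K -> K) : continuous f ->
  measurable_fun setT (f : borel K * borel K -> borel K).
Proof.
move=> cf; apply: (@measurability _ _ (borel K * borel K)%type (borel K) setT f (@open K)) => //.
by move=> _ [A oA <-]; rewrite setTI; apply: open_prod_measurable; exact: open_comp.
Qed.

Lemma measurable_local_sub :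
  measurable_fun setT (fun z : borel K * borel K => (z.1 : K) - (z.2 : K) : borel K).
Proof. exact: (continuous_prod_measurable (@local_sub_continuous K)). Qed.

Lemma measurable_local_mul :
  measurable_fun setT (fun z : borel K * borel K => (z.1 : K) * (z.2 : K) : borel K).
Proof. exact: (continuous_prod_measurable (@local_mul_continuous K)). Qed.

(** Inversion is continuous off 0 only. The preimage of an open set splits into its nonzero part,
    which is open, and its trace on {0}, which is a point or empty. *)
Lemma measurable_local_inv :
  measurable_fun setT (fun x : borel K => (x : K)^-1 : borel K).
Proof.
apply: (@measurability _ _ (borel K) (borel K) setT _ (@open K)) => //.
move=> _ [A oA <-]; rewrite setTI.
rewrite (_ : _ @^-1` _ = ([set x : K | x != 0] `&` [set x : K | A x^-1]) `|`
    ([set x : K | x = 0] `&` [set x : K | A x^-1])); last first.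
  rewrite -setIUl; apply/seteqP; split=> [x Ax|x []//]; split=> //=.
  by have [->|x0] := eqVneq x 0; [right|left].
apply: measurableU.
  apply: borel_open; rewrite openE => x [/= x0 Ax].
  have xA : \forall y \near x, A y^-1.
    by apply: (local_inv_continuous x x0 A); exact: open_nbhs_nbhs.
  by apply: filterS2 (nbhs_neq0 x0) xA => y.
have [A0|A0] := pselect (A (0 : K)^-1).
  rewrite (_ : _ `&` _ = [set (0 : K)]); first exact: borel_set1.
  by apply/seteqP; split=> [x [] //|x ->].
rewrite (_ : _ `&` _ = set0)//.
by apply/seteqP; split=> // x [/= ->].
Qed.

Section Composition.
Context {d} {T : measurableType d}.
Implicit Types f g : T -> borel K.

Lemma measurable_fun_local_sub f g : measurable_fun setT f ->
  measurable_fun setT g ->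
  measurable_fun setT (fun t => (f t : K) - (g t : K) : borel K).
Proof.
move=> mf mg; exact: (measurableT_comp measurable_local_sub (measurable_fun_pair mf mg)).
Qed.

Lemma measurable_fun_local_mul f g : measurable_fun setT f ->
  measurable_fun setT g ->
  measurable_fun setT (fun t => (f t : K) * (g t : K) : borel K).
Proof.
move=> mf mg; exact: (measurableT_comp measurable_local_mul (measurable_fun_pair mf mg)).
Qed.

Lemma measurable_fun_local_inv f : measurable_fun setT f ->
  measurable_fun setT (fun t => (f t : K)^-1 : borel K).
Proof. by move=> mf; exact: (measurableT_comp measurable_local_inv mf). Qed.

End Composition.

End SecondCountable.

(** * Affine changes of variables *)

Section HaarChangeOfVariables.
Context {R : realType} {K : localFieldType}.
Variables (mu : {sigma_finite_measure set (borel K) -> \bar R}) (abs : K -> R).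
Hypothesis mu_haar : is_haar mu.
Hypothesis abs_modulus : is_haar_modulus mu abs.

Lemma measurable_local_div_sub : measurable_fun setT
  (fun z : (borel K * borel K) * borel K =>
     ((z.2 : K) - (z.1.2 : K)) / (z.1.1 : K) : borel K).
Proof.
have m11 : measurable_fun setT (fun z : (borel K * borel K) * borel K => z.1.1).
  exact: (measurableT_comp measurable_fst measurable_fst).
have m12 : measurable_fun setT (fun z : (borel K * borel K) * borel K => z.1.2).
  exact: (measurableT_comp measurable_snd measurable_fst).
apply: (measurable_fun_local_mul mu_haar abs_modulus).
  by apply: (measurable_fun_local_sub mu_haar abs_modulus) => //; exact: measurable_snd.
exact: measurable_fun_local_inv m11.
Qed.

(** For nonzero a, |a| is mu(a V) / mu(V), and a V is the section at a of a measurable set of the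
    product, so its measure depends measurably on a. At 0 the section is not 0 V, whence the
    indicator. *)
Lemma measurable_modulus : measurable_fun setT (abs : borel K -> R).
Proof.
have [V [p [[V0 cV Vp p0] [p1 pV]]]] := exists_contraction mu_haar abs_modulus.
have mV := borel_compact cV.
pose S : set (borel K * borel K) := [set z | V ((z.1 : K)^-1 * (z.2 : K))].
have mS : measurable S.
  have mf : measurable_fun setT (fun z : borel K * borel K =>
      (z.1 : K)^-1 * (z.2 : K) : borel K).
    apply: (measurable_fun_local_mul mu_haar abs_modulus); last exact: measurable_snd.
    exact: (measurable_fun_local_inv measurable_fst).
  by have := mf measurableT _ mV; rewrite setTI.
have v0 := haar_nbhs_gt0 mu_haar V0 mV.
have voo : (mu V < +oo)%E by case: mu_haar => _ _ h _ _; exact: h.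
have [v vE] : exists v : R, mu V = v%:E.
  by exists (fine (mu V)); rewrite fineK// ge0_fin_numE// ltW.
have {}v0 : 0 < v by rewrite -lte_fin -vE.
rewrite (_ : (abs : borel K -> R) = fun a => \1_(~` [set (0 : K)]) a *
    (fine ((mu \o xsection S) a) * v^-1)).
  apply: measurable_funM.
    by apply: measurable_indic; apply: measurableC; exact: borel_set1.
  apply: measurable_funM => //; apply: measurableT_comp; first exact: fine_measurable.
  exact: measurable_fun_xsection.
apply/funext => a; have [->|a0] := eqVneq a 0.
  rewrite (modulus0 abs_modulus) indicE (_ : _ \in _ = false) ?mul0r//.
  by apply/negbTE/negP => /set_mem /(_ erefl).
rewrite indicE mem_set/=; last exact/eqP.
rewrite mul1r /= (_ : xsection S a = [set a * x | x in V]).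
  have -> : mu [set a * x | x in V] = ((abs a)%:E * v%:E)%E.
    by rewrite -vE; exact: (abs_modulus.2 a V a0 mV).
  by rewrite /= mulfK// gt_eqF.
rewrite image_mull//; apply/seteqP; split=> y /=.
  by move/xsectionP.
by move=> Vy; apply/xsectionP.
Qed.

Lemma closed_ball_measurable (r : R) :
  measurable ([set x | abs x <= r] : set (borel K)).
Proof.
have := measurable_modulus measurableT (measurable_itv `]-oo, r]).
by rewrite setTI; congr measurable; apply/funext => x /=; rewrite in_itv.
Qed.

Lemma closed_ball_fin (r : R) : (mu [set x | (abs x <= r)%R] < +oo)%E.
Proof.
have [V [p [[V0 cV Vp p0] [p1 pV]]]] := exists_contraction mu_haar abs_modulus.
have [n nP] := closed_ball_absorbed mu_haar abs_modulus V0 cV Vp p0 p1 pV r.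
have cC := @compact_mull K (p ^+ n)^-1 V cV.
apply: (@le_lt_trans _ _ (mu [set (p ^+ n)^-1 * x | x in V])); last first.
  by case: mu_haar => _ _ h _ _; exact: h.
apply: le_measure; rewrite ?inE.
- exact: closed_ball_measurable.
- exact: borel_compact.
- move=> x xr; exists (p ^+ n * x); first exact: nP.
  by rewrite mulrA mulVf ?mul1r// expf_neq0.
Qed.

Variables (a b : K).
Hypothesis a0 : a != 0.

Let phi (x : borel K) : borel K := ((x : K) - b) / a.

Let mphi : measurable_fun setT phi.
Proof.
rewrite (_ : phi = (fun x : K => a^-1 * x) \o (fun x : K => - b + x)).
  apply: continuous_borel_measurable => x.
  by apply: continuous_comp; [exact: addl_continuous|exact: mull_continuous].
by apply/funext => y; rewrite /phi /= mulrC addrC.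
Qed.

Let phiE (A : set (borel K)) : measurable A -> mu (phi @^-1` A) = ((abs a)%:E * mu A)%E.
Proof.
move=> mA; case: abs_modulus => _ /(_ _ _ a0 mA) <-.
have mI := borel_image_mull a0 mA.
case: mu_haar => _ /(_ b _ mI) <- _ _ _; congr (mu _).
rewrite image_mull// image_addl; apply/seteqP; split=> x; rewrite /phi /= mulrC//.
Qed.

(** The preimage of A under x -> (x - b) / a is the translate by b of a A, so mu is pushed forward
    to |a| mu. *)
Lemma ge0_integral_affine (f : borel K -> \bar R) : measurable_fun setT f ->
  (forall x, 0 <= f x)%E ->
  (\int[mu]_x f (((x : K) - b) / a)%R = (abs a)%:E * \int[mu]_x f x)%E.
Proof.
move=> mf f0.
have := @ge0_integral_pushforward _ _ _ _ R phi mphi mu setT f measurableT mf (fun y _ => f0 y).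
rewrite preimage_setT => <-.
have aa := modulus_ge0 mu_haar abs_modulus a.
rewrite -(ge0_integral_mscale mu measurableT (NngNum aa))//.
by apply: eq_measure_integral => A mA _; exact: phiE mA.
Qed.

End HaarChangeOfVariables.

Section ComplexChangeOfVariables.
Context {R : realType} {K : localFieldType}.
Variables (mu : {sigma_finite_measure set (borel K) -> \bar R}) (abs : K -> R).
Hypothesis mu_haar : is_haar mu.
Hypothesis abs_modulus : is_haar_modulus mu abs.
Implicit Types (a b : K) (f : borel K -> R[i]).

Lemma measurable_affine a b :
  measurable_fun setT (fun x : borel K => ((x : K) - b) / a : borel K).
Proof.
apply: (measurable_fun_local_mul mu_haar abs_modulus) => //.
exact: (measurable_fun_local_sub mu_haar abs_modulus).
Qed.

Lemma sqnorm_affine a b f : a != 0 -> cmeasurable f ->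
  sqnorm mu (fun x : borel K => f (((x : K) - b) / a)) =
  ((abs a)%:E * sqnorm mu f)%E.
Proof.
move=> a0 mf; rewrite /sqnorm -(ge0_integral_affine mu_haar abs_modulus b a0)//.
  exact: measurable_sqr_normc.
by move=> x; rewrite lee_fin sqr_ge0.
Qed.

Lemma cmeasurable_affine a b f : cmeasurable f ->
  cmeasurable (fun x : borel K => f (((x : K) - b) / a)).
Proof. by move=> mf; exact: (cmeasurable_comp (measurable_affine a b) mf). Qed.

Lemma cintegrable_affine a b f : a != 0 -> cintegrable mu setT f ->
  cintegrable mu setT (fun x : borel K => f (((x : K) - b) / a)).
Proof.
move=> a0 /cintegrableP[mf foo]; apply/cintegrableP; split.
  exact: cmeasurable_affine.
rewrite (ge0_integral_affine mu_haar abs_modulus b a0 (measurable_normcE mf)).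
  by rewrite lte_mul_pinfty// lee_fin (modulus_ge0 mu_haar abs_modulus).
by move=> x; rewrite lee_fin normc_ge0.
Qed.

Let Rintegral_affine a b (r : borel K -> R) : a != 0 ->
  mu.-integrable setT (EFin \o r) ->
  Rintegral mu setT (fun x : borel K => r (((x : K) - b) / a)) =
  abs a * Rintegral mu setT r.
Proof.
move=> a0 ir; rewrite /Rintegral.
have mr : measurable_fun setT (EFin \o r) by exact: measurable_int ir.
have -> : (\int[mu]_x (r (((x : K) - b) / a)%R)%:E =
    (abs a)%:E * \int[mu]_x (r x)%:E)%E; last first.
  by rewrite fineM// (integrable_fin_num _ ir).
rewrite integralE [in RHS]integralE muleBr//; last first.
  by apply: fin_num_adde_defl; rewrite fin_numN; exact: integrable_neg_fin_num ir.
congr (_ - _)%E.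
  rewrite -(ge0_integral_affine mu_haar abs_modulus b a0 (measurable_funepos mr))//.
  by apply: eq_integral => x _; rewrite !funeposE.
rewrite -(ge0_integral_affine mu_haar abs_modulus b a0 (measurable_funeneg mr))//.
by apply: eq_integral => x _; rewrite !funenegE.
Qed.

Lemma cintegral_affine a b f : a != 0 -> cintegrable mu setT f ->
  cintegral mu setT (fun x : borel K => f (((x : K) - b) / a)) =
  (abs a)%:C * cintegral mu setT f.
Proof.
move=> a0 [fR fI]; rewrite /cintegral.
rewrite (Rintegral_affine b a0 fR) (Rintegral_affine b a0 fI).
by apply/eqP; rewrite eq_complex /= !mul0r subr0 addr0 !eqxx.
Qed.

Lemma modulusN a : abs (- a) = abs a.
Proof.
have a1 : abs (- 1) = 1.
  apply/eqP; rewrite -(@eqrXn2 _ 2)//; last exact: (modulus_ge0 mu_haar abs_modulus).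
  rewrite expr1n -(modulusX mu_haar abs_modulus) sqrrN expr1n.
  by rewrite (modulus1 mu_haar abs_modulus).
by rewrite -mulN1r (modulusM mu_haar abs_modulus) a1 mul1r.
Qed.

End ComplexChangeOfVariables.

(** * The wavelet transform *)

Section Plancherel.
Context {R : realType} {K : localFieldType}.
Variables (mu : {sigma_finite_measure set (borel K) -> \bar R}) (abs : K -> R)
  (chi : K -> R[i]).
Hypothesis mu_haar : is_haar mu.
Hypothesis abs_modulus : is_haar_modulus mu abs.
Hypothesis chi_char : unitary_character chi.
Hypothesis mu_parseval : parseval mu chi.
Implicit Types (u v f g : borel K -> R[i]) (a b xi : K).

Lemma continuous_real_borel (r : K -> R) : continuous r ->
  measurable_fun setT (r : borel K -> R).
Proof.
move=> cr; apply: (@measurability _ _ (borel K) _ setT _ _ (RGenOInfty.measurableE R)).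
move=> _ [_ [y ->] <-]; rewrite setTI; apply: borel_open.
by apply: open_comp => //; exact: interval_open.
Qed.

Lemma cmeasurable_char : cmeasurable (chi : borel K -> R[i]).
Proof.
case: chi_char => cchi _ _.
have key (x : K) (e : R) : 0 < e -> \forall y \near x, normc (chi x - chi y) < e.
  move=> e0; have /cvgrPdist_lt/(_ e%:C) := cchi x.
  rewrite ltcR => /(_ e0); apply: filterS => y.
  by rewrite -[`| _ |]/((normc _)%:C) ltcR.
split; apply: continuous_real_borel => x; apply/cvgrPdist_lt => e e0.
  apply: filterS (key x e e0) => y; apply: le_lt_trans.
  by rewrite -ReN -ReD; exact: norm_Re_le.
apply: filterS (key x e e0) => y; apply: le_lt_trans.
by rewrite -ImN -ImD; exact: norm_Im_le.
Qed.

Lemma normc_char x : normc (chi x) = 1.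
Proof.
case: chi_char => _ _ /(_ x) h; apply: (@complexI R); rewrite -[RHS]h.
by [].
Qed.

Lemma cmeasurable_twist xi : cmeasurable (twist_char chi xi : borel K -> R[i]).
Proof.
apply: (cmeasurable_comp (f := chi : borel K -> R[i])
  (phi := fun x : borel K => (x : K) * xi : borel K)); last exact: cmeasurable_char.
exact: (measurable_fun_local_mul mu_haar abs_modulus).
Qed.

Lemma cintegrable_twist u xi : cintegrable mu setT u ->
  cintegrable mu setT (fun x : borel K => u x * (twist_char chi xi x)^*).
Proof.
move=> /cintegrableP[mU uoo]; apply/cintegrableP; split.
  by apply: cmeasurableM => //; apply: cmeasurable_conj; exact: cmeasurable_twist.
by under eq_integral do rewrite normcM normc_conj normc_char mulr1.
Qed.

Lemma fourierD u v : cintegrable mu setT u -> cintegrable mu setT v ->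
  fourier mu chi (fun x => u x + v x) =
  (fun xi => fourier mu chi u xi + fourier mu chi v xi).
Proof.
move=> iu iv; apply/funext => xi; rewrite /fourier -cintegralD; try exact: cintegrable_twist.
by apply: eq_cintegral => x _; rewrite mulrDl.
Qed.

Lemma fourierZ (c : R[i]) u : cintegrable mu setT u ->
  fourier mu chi (fun x => c * u x) = (fun xi => c * fourier mu chi u xi).
Proof.
move=> iu; apply/funext => xi; rewrite /fourier -cintegralZ; try exact: cintegrable_twist.
by apply: eq_cintegral => x _; rewrite mulrA.
Qed.

Lemma L2_fourier u : cintegrable mu setT u -> L2 mu u -> L2 mu (fourier mu chi u).
Proof. by move=> /cLp1P u1 /cLp2P u2; have [/cLp2P] := mu_parseval u1 u2. Qed.

Lemma sqnorm_fourier u : cintegrable mu setT u -> L2 mu u ->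
  sqnorm mu (fourier mu chi u) = sqnorm mu u.
Proof.
move=> /cLp1P u1 /cLp2P u2; have [_] := mu_parseval u1 u2.
exact: sqnorm_cLnorm2.
Qed.

(** Parseval polarized, with constant 1. *)
Lemma cdot_fourier u v : cintegrable mu setT u -> L2 mu u ->
  cintegrable mu setT v -> L2 mu v ->
  cdot mu u v = cdot mu (fourier mu chi u) (fourier mu chi v).
Proof.
move=> u1 u2 v1 v2; symmetry; rewrite -[RHS]mul1r.
apply: (@cdot_polarization _ _ _ _ _ mu mu 1); try exact: L2_fourier; try by [].
  move=> a; rewrite mul1e -[in RHS]sqnorm_fourier.
  - by rewrite fourierD ?fourierZ//; exact: cintegrableZ.
  - by apply: cintegrableD => //; exact: cintegrableZ.
  - by apply: L2D => //; exact: L2Z.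
by rewrite mul1e sqnorm_fourier.
Qed.

(** The Fourier transform of the wavelet of u, expressed through the transform of u so that it still
    makes sense when only an L^2 transform is given. *)
Definition fourier_wavelet (uhat : borel K -> R[i]) a b (xi : borel K) : R[i] :=
  ((Num.sqrt (abs a))%:C * (chi ((b : K) * xi))^*) * uhat ((a : K) * xi).

Lemma wavelet_affineE u a b :
  wavelet abs u a b = (fun x : borel K =>
    ((Num.sqrt (abs a))^-1)%:C * u (((x : K) - b) / a)).
Proof. by []. Qed.

Let sqrt_abs_gt0 a : a != 0 -> 0 < Num.sqrt (abs a).
Proof. by move=> a0; rewrite sqrtr_gt0 (modulus_gt0 mu_haar abs_modulus). Qed.

Lemma cintegrable_wavelet u a b : a != 0 -> cintegrable mu setT u ->
  cintegrable mu setT (wavelet abs u a b : borel K -> R[i]).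
Proof.
move=> a0 iu; rewrite wavelet_affineE; apply: cintegrableZ.
exact: (cintegrable_affine mu_haar abs_modulus).
Qed.

Lemma cmeasurable_wavelet u a b : cmeasurable u ->
  cmeasurable (wavelet abs u a b : borel K -> R[i]).
Proof.
move=> mU; rewrite wavelet_affineE; apply: cmeasurableM; first exact: cmeasurable_cst.
exact: (cmeasurable_affine mu_haar abs_modulus).
Qed.

Lemma sqnorm_wavelet u a b : a != 0 -> cmeasurable u ->
  sqnorm mu (wavelet abs u a b) = sqnorm mu u.
Proof.
move=> a0 mU; rewrite wavelet_affineE sqnormZ; last exact: (cmeasurable_affine mu_haar abs_modulus).
rewrite (sqnorm_affine mu_haar abs_modulus b a0)// normc_real.
rewrite ger0_norm ?invr_ge0 ?sqrtr_ge0// exprVn sqr_sqrtr; last first.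
  exact: (modulus_ge0 mu_haar abs_modulus).
by rewrite muleA -EFinM mulVf ?mul1e// gt_eqF// (modulus_gt0 mu_haar abs_modulus).
Qed.

Lemma wavelet0 u b : wavelet abs u 0 b = (fun=> 0).
Proof.
by apply/funext => x; rewrite /wavelet (modulus0 abs_modulus) sqrtr0 invr0 mul0r.
Qed.

Lemma L2_wavelet u a b : L2 mu u -> L2 mu (wavelet abs u a b).
Proof.
move=> [mU uoo]; split; first exact: cmeasurable_wavelet.
have [->|a0] := eqVneq a 0; last by rewrite sqnorm_wavelet.
rewrite wavelet0 /sqnorm; under eq_integral do rewrite normc0 expr0n/=.
by rewrite integral0.
Qed.

(** Substituting x = b + a y pulls out the conjugate of chi(b xi) and turns the frequency into a xi;
    the factor |a| of the substitution against |a|^(-1/2) leaves |a|^(1/2). *)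
Lemma fourier_waveletE u a b : a != 0 -> cintegrable mu setT u ->
  fourier mu chi (wavelet abs u a b) = fourier_wavelet (fourier mu chi u) a b.
Proof.
move=> a0 iu; apply/funext => xi.
have chiM : forall x y, chi (x + y) = chi x * chi y by case: chi_char.
pose k (y : borel K) : R[i] := (((Num.sqrt (abs a))^-1)%:C * (chi (b * xi))^*) *
  (u y * (twist_char chi (a * xi) y)^*).
have ik : cintegrable mu setT k.
  by apply: cintegrableZ; exact: cintegrable_twist.
transitivity (cintegral mu setT (fun x : borel K => k (((x : K) - b) / a))).
  apply: eq_cintegral => x _; rewrite /k wavelet_affineE /twist_char.
  have -> : (x : K) * xi = b * xi + ((x : K) - b) / a * (a * xi).
    by field.
  by rewrite chiM cconjM; ring.
rewrite (cintegral_affine mu_haar abs_modulus)//.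
rewrite cintegralZ; last exact: cintegrable_twist.
rewrite /fourier_wavelet -/(fourier mu chi u (a * xi)) !mulrA.
congr (_ * _ * _); rewrite -rmorphM /=; congr (_%:C).
rewrite -[X in X * _]sqr_sqrtr; last exact: (modulus_ge0 mu_haar abs_modulus).
by rewrite expr2 mulfK// gt_eqF// sqrt_abs_gt0.
Qed.

End Plancherel.

(** * The wavelet transform on the Fourier side *)

Section WaveletFourier.
Context {R : realType} {K : localFieldType}.
Variables (mu : {sigma_finite_measure set (borel K) -> \bar R}) (abs : K -> R)
  (chi : K -> R[i]).
Hypothesis mu_haar : is_haar mu.
Hypothesis abs_modulus : is_haar_modulus mu abs.
Hypothesis chi_char : unitary_character chi.
Hypothesis mu_parseval : parseval mu chi.
Implicit Types (u v f g : borel K -> R[i]) (a b xi : K).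

Let abs_gt0 a : a != 0 -> 0 < abs a.
Proof. exact: (modulus_gt0 mu_haar abs_modulus). Qed.

Let abs_ge0 a : 0 <= abs a.
Proof. exact: (modulus_ge0 mu_haar abs_modulus). Qed.

Lemma ge0_integral_dilation a (k : borel K -> \bar R) : a != 0 ->
  measurable_fun setT k -> (forall x, 0 <= k x)%E ->
  (\int[mu]_x k ((a : K) * x)%R = ((abs a)^-1)%:E * \int[mu]_x k x)%E.
Proof.
move=> a0 mk k0; have a'0 : a^-1 != 0 by rewrite invr_eq0.
rewrite -(modulusV mu_haar abs_modulus).
rewrite -(ge0_integral_affine mu_haar abs_modulus 0 a'0 mk k0).
by apply: eq_integral => x _; rewrite subr0 invrK mulrC.
Qed.

Let measurable_mull a :
  measurable_fun setT (fun x : borel K => (a : K) * x : borel K).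
Proof. exact: continuous_borel_measurable (@mull_continuous K a). Qed.

Let cmeasurable_dilation a u : cmeasurable u ->
  cmeasurable (fun x : borel K => u ((a : K) * x)).
Proof. by move=> mU; exact: (cmeasurable_comp (measurable_mull a) mU). Qed.

Lemma sqnorm_dilation a u : a != 0 -> cmeasurable u ->
  sqnorm mu (fun x : borel K => u ((a : K) * x)) = (((abs a)^-1)%:E * sqnorm mu u)%E.
Proof.
move=> a0 mU; rewrite /sqnorm -(ge0_integral_dilation a0)//.
  exact: measurable_sqr_normc.
by move=> x; rewrite lee_fin sqr_ge0.
Qed.

Lemma cmeasurable_fourier_wavelet u a b : cmeasurable u ->
  cmeasurable (fourier_wavelet abs chi u a b).
Proof.
move=> mU; apply: cmeasurableM; last exact: cmeasurable_dilation.
apply: cmeasurableM; first exact: cmeasurable_cst.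
apply: cmeasurable_conj.
exact: (cmeasurable_comp (measurable_mull b) (cmeasurable_char chi_char)).
Qed.

Lemma sqnorm_fourier_wavelet u a b : a != 0 -> cmeasurable u ->
  sqnorm mu (fourier_wavelet abs chi u a b) = sqnorm mu u.
Proof.
move=> a0 mU.
rewrite (@eq_sqnorm _ _ _ _ _ (fun xi : borel K => (Num.sqrt (abs a))%:C * u ((a : K) * xi))).
  rewrite sqnormZ ?sqnorm_dilation//; last exact: cmeasurable_dilation.
  rewrite normc_real ger0_norm ?sqrtr_ge0// sqr_sqrtr// muleA -EFinM.
  by rewrite mulfV ?mul1e// gt_eqF// abs_gt0.
by move=> xi; rewrite /fourier_wavelet !normcM normc_conj (normc_char chi_char) mulr1.
Qed.

Lemma L2_fourier_wavelet u a b : a != 0 -> L2 mu u ->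
  L2 mu (fourier_wavelet abs chi u a b).
Proof.
move=> a0 [mU uoo]; split; first exact: cmeasurable_fourier_wavelet.
by rewrite sqnorm_fourier_wavelet.
Qed.

Variables psi psihat : K -> R[i].
Hypothesis psihat_fourier : is_fourierL2 mu chi psi psihat.

Let psi_L2 : L2 mu psi.
Proof. by case: psihat_fourier => /cLp2P. Qed.

Let psihat_L2 : L2 mu psihat.
Proof. by case: psihat_fourier => _ /cLp2P. Qed.

(** True for the integrable approximants of psi that define psihat. Forming wavelets preserves the
    norm on both sides, so the approximation survives it and [cdot_lim] applies. *)
Lemma wavelet_transform_fourier f a b : a != 0 ->
  cintegrable mu setT f -> L2 mu f ->
  wavelet_transform mu abs psi f a b =
  cdot mu (fourier mu chi f) (fourier_wavelet abs chi psihat a b).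
Proof.
move=> a0 f1 f2; case: psihat_fourier => _ _ [u [uL]].
move=> /cLnorm2_cvg0 upsi /cLnorm2_cvg0 uhpsi.
have u1 n : cintegrable mu setT (u n) by apply/cLp1P; case: (uL n).
have u2 n : L2 mu (u n) by apply/cLp2P; case: (uL n).
have uh2 n : L2 mu (fourier mu chi (u n)) by exact: L2_fourier.
rewrite -[LHS]mul1r; apply: (@cdot_lim _ _ _ _ _ mu mu 1 f _ _ _
   (fun n => wavelet abs (u n) a b)
   (fun n => fourier_wavelet abs chi (fourier mu chi (u n)) a b)).
- by [].
- exact: (L2_wavelet mu_haar abs_modulus).
- exact: L2_fourier.
- exact: L2_fourier_wavelet.
- by move=> n; exact: (L2_wavelet mu_haar abs_modulus).
- by move=> n; exact: L2_fourier_wavelet.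
- move=> e e0; apply: filterS (upsi e e0) => n; congr (_ < _)%E.
  rewrite -(sqnorm_wavelet mu_haar abs_modulus b a0); last first.
    exact: L2_meas (L2B (u2 n) psi_L2).
  by apply: eq_sqnorm => x; rewrite /wavelet -mulrBr.
- move=> e e0; apply: filterS (uhpsi e e0) => n; congr (_ < _)%E.
  rewrite -(sqnorm_fourier_wavelet b a0); last first.
    exact: L2_meas (L2B (uh2 n) psihat_L2).
  by apply: eq_sqnorm => x; rewrite /fourier_wavelet -mulrBr.
- move=> n; rewrite mul1r -(fourier_waveletE mu_haar abs_modulus chi_char b a0)//.
  have w1 := cintegrable_wavelet mu_haar abs_modulus b a0 (u1 n).
  have w2 := L2_wavelet mu_haar abs_modulus a b (u2 n).
  exact: (cdot_fourier mu_haar abs_modulus chi_char mu_parseval f1 f2 w1 w2).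
Qed.

(** For nonzero a and f in L^1 and L^2, the wavelet transform at scale a is the inverse Fourier
    integral of this function. *)
Definition scale_spectrum f a (xi : borel K) : R[i] :=
  fourier mu chi f xi * ((Num.sqrt (abs a))%:C * (psihat ((a : K) * xi))^*).

Let L2_scale_factor a : a != 0 ->
  L2 mu (fun xi : borel K => (Num.sqrt (abs a))%:C * (psihat ((a : K) * xi))^*).
Proof.
move=> a0; apply: L2Z; apply: L2_conj; case: psihat_L2 => mp poo; split.
  exact: cmeasurable_dilation.
by rewrite sqnorm_dilation// lte_mul_pinfty// lee_fin invr_ge0.
Qed.

(* At a fixed scale the wavelet transform is, up to conjugation, the Fourier
   transform of an integrable function, so that Parseval applies to it as soon
   as that function is square integrable. *)
Lemma sqnorm_wavelet_transform f a : a != 0 ->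
  cintegrable mu setT f -> L2 mu f -> (sqnorm mu (scale_spectrum f a) < +oo)%E ->
  sqnorm mu (fun b : borel K => wavelet_transform mu abs psi f a b) =
  sqnorm mu (scale_spectrum f a).
Proof.
move=> a0 f1 f2 foo.
have fh2 : L2 mu (fourier mu chi f) by exact: L2_fourier.
have F1 : cintegrable mu setT (scale_spectrum f a).
  by apply: L2_mul_cintegrable => //; exact: L2_scale_factor.
have F2 : L2 mu (scale_spectrum f a) by split => //; exact: cintegrable_meas F1.
rewrite [RHS](_ : _ = sqnorm mu (fun xi => (scale_spectrum f a xi)^*)); last first.
  by apply: eq_sqnorm => xi; rewrite normc_conj.
rewrite -(sqnorm_fourier mu_parseval (cintegrable_conj F1) (L2_conj F2)).
apply: eq_sqnorm => b; rewrite -normc_conj wavelet_transform_fourier//; congr normc.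
rewrite -cdot_conj//; last exact: L2_fourier_wavelet.
apply: eq_cintegral => xi _; rewrite /fourier_wavelet /scale_spectrum /twist_char !cconjM.
by rewrite cconjK cconj_real (mulrC xi b); ring.
Qed.

(** The weight |a|^-2 is shared equally between coefficient and wavelet, so that the reconstruction
    is an integral against the product measure itself. *)
Definition scaled_wavelet (z : borel K * borel K) (x : borel K) : R[i] :=
  ((abs z.1)^-1)%:C * wavelet abs psi z.1 z.2 x.

Lemma L2_scaled_wavelet z : L2 mu (scaled_wavelet z).
Proof. by apply: L2Z; exact: (L2_wavelet mu_haar abs_modulus). Qed.

Lemma cmeasurable_scaled_wavelet :
  cmeasurable (fun p : (borel K * borel K) * borel K => scaled_wavelet p.1 p.2).
Proof.
have mV : measurable_fun setT (fun p : (borel K * borel K) * borel K => (abs p.1.1)^-1).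
  under eq_fun do rewrite -(modulusV mu_haar abs_modulus).
  apply: (measurableT_comp (measurable_modulus mu_haar abs_modulus)
    (g := fun p : (borel K * borel K) * borel K => (p.1.1 : K)^-1 : borel K)).
  apply: measurable_fun_local_inv.
  exact: (measurableT_comp measurable_fst measurable_fst).
apply: cmeasurableM; first exact: cmeasurable_real.
apply: cmeasurableM.
  apply: cmeasurable_real; under eq_fun do rewrite -sqrtrV//.
  exact: (measurableT_comp (continuous_measurable_fun (@sqrt_continuous R)) mV).
exact: (cmeasurable_comp (measurable_local_div_sub mu_haar abs_modulus) (L2_meas psi_L2)).
Qed.

Lemma analysisE f z : L2 mu f ->
  analysis mu scaled_wavelet f z =
  ((abs z.1)^-1)%:C * wavelet_transform mu abs psi f z.1 z.2.
Proof.
move=> f2; rewrite /analysis /scaled_wavelet cdotZr//.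
  by rewrite cconj_real.
exact: (L2_wavelet mu_haar abs_modulus).
Qed.

End WaveletFourier.

(** * The isometry property of the wavelet transform *)

Section WaveletIsometry.
Context {R : realType} {K : localFieldType}.
Variables (mu : {sigma_finite_measure set (borel K) -> \bar R}) (abs : K -> R)
  (chi : K -> R[i]).
Hypothesis mu_haar : is_haar mu.
Hypothesis abs_modulus : is_haar_modulus mu abs.
Hypothesis chi_char : unitary_character chi.
Hypothesis mu_parseval : parseval mu chi.
Implicit Types (u v f g : borel K -> R[i]) (a b xi : K).

Let abs_gt0 a : a != 0 -> 0 < abs a.
Proof. exact: (modulus_gt0 mu_haar abs_modulus). Qed.

Let abs_ge0 a : 0 <= abs a.
Proof. exact: (modulus_ge0 mu_haar abs_modulus). Qed.

Variables psi psihat : K -> R[i].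
Hypothesis psihat_fourier : is_fourierL2 mu chi psi psihat.

Let psi_L2 : L2 mu psi.
Proof. by case: psihat_fourier => /cLp2P. Qed.

Let psihat_L2 : L2 mu psihat.
Proof. by case: psihat_fourier => _ /cLp2P. Qed.

Local Notation C := (admissibility_constant mu abs psihat).
Local Notation G := (analysis mu (scaled_wavelet abs psi)).
Local Notation mu2 := (mu \x mu)%E.

Lemma admissibility_constant_ge0 : (0 <= C)%E.
Proof.
by apply: integral_ge0 => x _; rewrite lee_fin divr_ge0// sqr_ge0.
Qed.

(** The squared spectrum times |a|^-2. Being nonnegative it may be integrated in either order: first
    in xi it gives the norms at fixed scale, first in a the admissibility constant. *)
Let density f (p : borel K * borel K) : \bar R :=
  (normc (fourier mu chi f p.2) ^+ 2 *
   (normc (psihat ((p.1 : K) * p.2)) ^+ 2 / abs p.1))%:E.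

Let density_ge0 f p : (0 <= density f p)%E.
Proof. by rewrite lee_fin mulr_ge0 ?divr_ge0 ?sqr_ge0. Qed.

Let measurable_mod_inv : measurable_fun setT (fun a : borel K => (abs a)^-1).
Proof.
under eq_fun do rewrite -(modulusV mu_haar abs_modulus).
exact: (measurableT_comp (measurable_modulus mu_haar abs_modulus) measurable_local_inv).
Qed.

Let measurable_density f : L2 mu (fourier mu chi f) -> measurable_fun setT (density f).
Proof.
move=> fh2; apply/measurable_EFinP; apply: measurable_funM.
  apply: measurable_funX; apply: measurable_normc.
  exact: (cmeasurable_comp measurable_snd (L2_meas fh2)).
apply: measurable_funM.
  apply: measurable_funX; apply: measurable_normc.
  exact: (cmeasurable_comp (measurable_local_mul mu_haar abs_modulus) (L2_meas psihat_L2)).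
exact: (measurableT_comp measurable_mod_inv measurable_fst).
Qed.

Let sqr_normc_spectrum f a xi : normc (scale_spectrum mu abs chi psihat f a xi) ^+ 2 =
  normc (fourier mu chi f xi) ^+ 2 * (abs a * normc (psihat (a * xi)) ^+ 2).
Proof.
rewrite /scale_spectrum !normcM !exprMn normc_conj normc_real.
by rewrite ger0_norm ?sqrtr_ge0// (sqr_sqrtr (abs_ge0 a)).
Qed.

Let density_scale f a : L2 mu (fourier mu chi f) ->
  (\int[mu]_xi density f (a, xi) =
   ((abs a)^-2)%:E * sqnorm mu (scale_spectrum mu abs chi psihat f a))%E.
Proof.
move=> fh2; rewrite -ge0_integralZl//.
- apply: eq_integral => xi _; rewrite sqr_normc_spectrum /density -EFinM.
  congr EFin; rewrite [RHS]mulrCA; congr (_ * _).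
  (* At modulus 0 both sides vanish because 0^-1 = 0. *)
  have [a0|a0] := eqVneq (abs a) 0.
    by rewrite a0 expr0n /= invr0 !mulr0 mul0r.
  by field.
- apply: measurable_sqr_normc; apply: cmeasurableM; first exact: L2_meas fh2.
  apply: cmeasurableM; first exact: cmeasurable_cst.
  apply: cmeasurable_conj.
  apply: (cmeasurable_comp _ (L2_meas psihat_L2)).
  exact: continuous_borel_measurable (@mull_continuous K a).
- by move=> xi _; rewrite lee_fin sqr_ge0.
- by rewrite lee_fin invr_ge0 exprn_ge0.
Qed.

(* For nonzero [xi] the substitution a -> a / xi turns the integral over the
   scales into the admissibility constant. *)
Let integral_density f : L2 mu (fourier mu chi f) ->
  (\int[mu]_a \int[mu]_xi density f (a, xi) = C * sqnorm mu (fourier mu chi f))%E.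
Proof.
move=> fh2; rewrite (fubini_tonelli (density f) (measurable_density fh2) (density_ge0 f)).
rewrite -[in RHS]ge0_integralZl//; last 3 first.
- exact: measurable_sqr_normc (L2_meas fh2).
- by move=> x _; rewrite lee_fin sqr_ge0.
- exact: admissibility_constant_ge0.
apply: ge0_ae_eq_integral => //.
- exact: (measurable_fun_fubini_tonelli_G _ (measurable_density fh2) (density_ge0 f)).
- by apply: measurable_funeM; exact: measurable_sqr_normc (L2_meas fh2).
- by move=> xi _; apply: integral_ge0 => a _; exact: density_ge0.
- by move=> xi _; rewrite mule_ge0 ?admissibility_constant_ge0// lee_fin sqr_ge0.
exists [set (0 : K)]; split; [exact: borel_set1|exact: (haar_set10 mu_haar)|].
move=> xi /= h; apply: contrapT => /eqP xi0; apply: h => _.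
pose k (y : borel K) : \bar R := (normc (psihat y) ^+ 2 / abs y)%:E.
have mk : measurable_fun setT k.
  apply/measurable_EFinP; apply: measurable_funM => //.
  by apply: measurable_funX; exact: measurable_normc (L2_meas psihat_L2).
have k0 y : (0 <= k y)%E by rewrite lee_fin divr_ge0// sqr_ge0.
have mkxi : measurable_fun setT (fun a : borel K => k ((xi : K) * a)).
  apply: (measurableT_comp mk).
  exact: continuous_borel_measurable (@mull_continuous K xi).
transitivity (\int[mu]_a ((normc (fourier mu chi f xi) ^+ 2 * abs xi)%:E *
    k ((xi : K) * a)%R))%E.
  apply: eq_integral => a _; rewrite /density /k /= -EFinM mulrC (mulrC (a : K)).
  rewrite (modulusM mu_haar abs_modulus) invfM; congr EFin.
  have := abs_gt0 xi0; move: (abs xi) (abs a)^-1 => s t s0.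
  by rewrite [RHS]mulrACA -mulrA; field; rewrite gt_eqF.
rewrite ge0_integralZl//; last by rewrite lee_fin mulr_ge0// sqr_ge0.
rewrite (ge0_integral_dilation mu_haar abs_modulus xi0 mk k0) muleA -EFinM.
by rewrite mulfK ?gt_eqF ?abs_gt0// muleC.
Qed.

Hypothesis psi_admissible : (C < +oo)%E.

(** By Tonelli both sides become integrals over the scales, which [density] compares at almost every
    a. *)
Lemma sqnorm_analysis_L1 f : cintegrable mu setT f -> L2 mu f ->
  sqnorm mu2 (G f) = (C * sqnorm mu f)%E.
Proof.
move=> f1 f2; have fh2 := L2_fourier mu_parseval f1 f2.
have mG := cmeasurable_analysis mu
  (cmeasurable_scaled_wavelet mu_haar abs_modulus psihat_fourier) (L2_meas f2).
rewrite sqnorm_tonelli1// -(sqnorm_fourier mu_parseval f1 f2) -integral_density//.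
have mD : measurable_fun setT (fun a : borel K => \int[mu]_xi density f (a, xi))%E.
  exact: (measurable_fun_fubini_tonelli_F _ (measurable_density fh2) (density_ge0 f)).
apply: ge0_ae_eq_integral => //.
- apply: (measurable_fun_fubini_tonelli_F (fun z => (normc (G f z) ^+ 2)%:E)).
    exact: measurable_sqr_normc.
  by move=> z; rewrite lee_fin sqr_ge0.
- by move=> a _; exact: sqnorm_ge0.
- by move=> a _; apply: integral_ge0 => xi _; exact: density_ge0.
(* Finiteness of the total integral makes the spectrum square integrable at almost every scale,
   which Parseval at that scale requires. *)
have iD : mu.-integrable setT (fun a : borel K => \int[mu]_xi density f (a, xi))%E.
  apply/integrableP; split => //.
  under eq_integral do rewrite gee0_abs ?integral_ge0//.
  rewrite integral_density// lte_mul_pinfty ?admissibility_constant_ge0//.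
    by rewrite ge0_fin_numE ?admissibility_constant_ge0.
  by case: fh2.
apply: filterS (integrable_ae measurableT iD) => a /(_ I) + _.
rewrite density_scale//.
rewrite (_ : (fun b => G f (a, b)) = fun b : borel K =>
    ((abs a)^-1)%:C * wavelet_transform mu abs psi f a b); last first.
  by apply/funext => b; rewrite (analysisE mu_haar abs_modulus psihat_fourier).
(* At a = 0 both sides are 0 by the convention on inverses. *)
have [->|a0] := eqVneq a 0.
  rewrite (modulus0 abs_modulus) [0 ^+ 2]expr2 mul0r !invr0 mul0e => _.
  rewrite /sqnorm; under eq_integral do rewrite mul0r normc0 expr0n/=.
  by rewrite integral0.
have a2 : 0 < (abs a) ^- 2 by rewrite invr_gt0 exprn_gt0// abs_gt0.
move=> sfin; have {}sfin : (sqnorm mu (scale_spectrum mu abs chi psihat f a) < +oo)%E.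
  rewrite ltey; apply/eqP => soo; move: sfin.
  by rewrite soo mulry gtr0_sg// mul1e.
have mW : cmeasurable (fun b : borel K => wavelet_transform mu abs psi f a b).
  rewrite (_ : (fun b => _) = fun b => (abs a)%:C * G f (a, b)).
    apply: cmeasurableM; first exact: cmeasurable_cst.
    exact: (cmeasurable_comp (pair1_measurable (a : borel K)) mG).
  apply/funext => b; rewrite (analysisE mu_haar abs_modulus psihat_fourier)//=.
  by rewrite mulrA -rmorphM/= mulfV ?mul1r// gt_eqF// abs_gt0.
rewrite sqnormZ// (sqnorm_wavelet_transform mu_haar abs_modulus chi_char mu_parseval
  psihat_fourier a0 f1 f2 sfin).
by rewrite normc_real ger0_norm ?invr_ge0// exprVn.
Qed.

(** Cuts f to an increasing sequence of sets of finite measure, whose indicators are square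
    integrable. The bound by the norm of f is what Fatou needs later. *)
Lemma L1_L2_dense f : L2 mu f -> exists u : nat -> borel K -> R[i],
  [/\ forall n, cintegrable mu setT (u n), forall n, L2 mu (u n),
      forall n, (sqnorm mu (u n) <= sqnorm mu f)%E &
      forall e : R, 0 < e -> \forall n \near \oo,
        (sqnorm mu (fun x => (u n x - f x)%R) < e%:E)%E].
Proof.
move=> f2; have /sigma_finiteP[F [FT ndF Ffin]] := sigma_finiteT mu.
have mF n : measurable (F n) by case: (Ffin n).
exists (fun n x => (\1_(F n) x)%:C * f x); split.
- move=> n; apply: L2_mul_cintegrable => //; split.
    by apply: cmeasurable_real; exact: measurable_indic.
  rewrite /sqnorm (eq_integral (fun x => (\1_(F n) x)%:E)); last first.
    move=> x _; rewrite normc_real indicE; case: (x \in F n).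
      by rewrite normr1 expr1n.
    by rewrite normr0 expr0n.
  by rewrite integral_indic// setIT; case: (Ffin n).
- by move=> n; exact: L2_indicM.
- move=> n; apply: le_sqnorm.
  + exact: L2_meas (L2_indicM (mF n) f2).
  + exact: L2_meas f2.
  + move=> x; rewrite indicM_if; case: ifP => // _.
    by rewrite normc0 normc_ge0.
- apply: sqnorm_indicM_cvg => // x _.
  have : setT x by [].
  by rewrite FT => -[n _ Fnx]; exists n.
Qed.

Let c := fine C.

Let cE : C = c%:E.
Proof. by rewrite /c fineK// ge0_fin_numE// admissibility_constant_ge0. Qed.

Let c_ge0 : 0 <= c.
Proof. by rewrite -lee_fin -cE admissibility_constant_ge0. Qed.

Let mh := cmeasurable_scaled_wavelet mu_haar abs_modulus psihat_fourier.

Let hL2 z : L2 mu (scaled_wavelet abs psi z).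
Proof. exact: (L2_scaled_wavelet mu_haar abs_modulus psihat_fourier). Qed.

(** Fatou yields only an inequality, but it makes the analysis operator continuous on L^2, and
    continuity then carries over the exact identity. *)
Let sqnorm_analysis_le f : L2 mu f -> (sqnorm mu2 (G f) <= C * sqnorm mu f)%E.
Proof.
move=> f2; have [u [u1 u2 uf cu]] := L1_L2_dense f2.
apply: (sqnorm_fatou (u := fun n => G (u n))).
- by move=> n; exact: (cmeasurable_analysis mu mh (L2_meas (u2 n))).
- move=> z; apply/cvgr0Pnorm_lt => e e0.
  (* The added 1 keeps the divisor positive where the wavelet vanishes. *)
  have M0 : 0 < fine (sqnorm mu (scaled_wavelet abs psi z)) + 1.
    by rewrite ltr_wpDl// fine_ge0// sqnorm_ge0.
  have := cu _ (divr_gt0 (exprn_gt0 2 e0) M0); apply: filterS => n un.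
  rewrite ger0_norm ?normc_ge0// -(ltr_pXn2r (ltn0Sn 1)) ?nnegrE ?normc_ge0 ?(ltW e0)//.
  have d2 := L2B (u2 n) f2.
  rewrite /analysis -cdotBl//; apply: le_lt_trans (sqr_cdot_le d2 (hL2 z)) _.
  rewrite -(L2_fin d2) lte_fin ltr_pdivlMr// in un; apply: le_lt_trans un.
  apply: ler_wpM2l; first by apply: fine_ge0; exact: sqnorm_ge0.
  by rewrite lerDl.
- move=> n; rewrite sqnorm_analysis_L1//.
  by rewrite lee_wpmul2l// admissibility_constant_ge0.
Qed.

Let L2_G f : L2 mu f -> L2 mu2 (G f).
Proof.
move=> f2; split; first exact: (cmeasurable_analysis mu mh (L2_meas f2)).
apply: le_lt_trans (sqnorm_analysis_le f2) _.
by rewrite cE lte_mul_pinfty ?lee_fin//; case: f2.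
Qed.

Let cdot_G_L1 f g : cintegrable mu setT f -> L2 mu f ->
  cintegrable mu setT g -> L2 mu g ->
  c%:C * cdot mu f g = cdot mu2 (G f) (G g).
Proof.
move=> f1 f2 g1 g2; symmetry; apply: cdot_polarization => //; try exact: L2_G.
  move=> a; rewrite -cE -sqnorm_analysis_L1.
  - by rewrite (analysisD hL2)//; [rewrite (analysisZ hL2)|exact: L2Z].
  - by apply: cintegrableD => //; exact: cintegrableZ.
  - by apply: L2D => //; exact: L2Z.
by rewrite -cE sqnorm_analysis_L1.
Qed.

Let G_cvg f (u : nat -> borel K -> R[i]) : L2 mu f -> (forall n, L2 mu (u n)) ->
  (forall e : R, 0 < e -> \forall n \near \oo,
     (sqnorm mu (fun x => (u n x - f x)%R) < e%:E)%E) ->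
  forall e : R, 0 < e -> \forall n \near \oo,
     (sqnorm mu2 (fun z => (G (u n) z - G f z)%R) < e%:E)%E.
Proof.
(* Only [0 <= c] is known here, hence the divisor c + 1. *)
move=> f2 u2 cu e e0; have c1 : 0 < c + 1 by rewrite ltr_wpDl.
have := cu _ (divr_gt0 e0 c1); apply: filterS => n un.
have d2 := L2B (u2 n) f2.
rewrite -(analysisB hL2)//; apply: le_lt_trans (sqnorm_analysis_le d2) _.
move: un; rewrite cE -(L2_fin d2) -EFinM !lte_fin ltr_pdivlMr//; apply: le_lt_trans.
rewrite mulrC; apply: ler_wpM2l; first by apply: fine_ge0; exact: sqnorm_ge0.
by rewrite lerDl.
Qed.

(** The limit is taken in one argument at a time: first on the right with u_m fixed on the left;
    conjugation then moves u_n to the right for the second limit. *)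
Lemma sqnorm_analysis f : L2 mu f -> sqnorm mu2 (G f) = (c%:E * sqnorm mu f)%E.
Proof.
move=> f2; have [u [u1 u2 _ cu]] := L1_L2_dense f2.
have h1 m : c%:C * cdot mu (u m) f = cdot mu2 (G (u m)) (G f).
  apply: (cdot_lim (u2 m) f2 (L2_G (u2 m)) (L2_G f2) u2 (fun n => L2_G (u2 n)) cu).
    exact: G_cvg.
  by move=> n; exact: cdot_G_L1.
have h2 : c%:C * cdot mu f f = cdot mu2 (G f) (G f).
  apply: (cdot_lim f2 f2 (L2_G f2) (L2_G f2) u2 (fun n => L2_G (u2 n)) cu).
    exact: G_cvg.
  move=> n; rewrite (cdot_conj (u2 n) f2) (cdot_conj (L2_G (u2 n)) (L2_G f2)).
  by rewrite -h1 cconjM cconj_real.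
move: h2; rewrite (cdot_sqnorm f2) (cdot_sqnorm (L2_G f2)) -rmorphM => /complexI h2.
by rewrite -(L2_fin (L2_G f2)) -(L2_fin f2) -EFinM h2.
Qed.

End WaveletIsometry.

(** * Truncation to scale boxes *)

Section ScaleBoxes.
Context {R : realType} {K : localFieldType}.
Variables (mu : {sigma_finite_measure set (borel K) -> \bar R}) (abs : K -> R).
Hypothesis mu_haar : is_haar mu.
Hypothesis abs_modulus : is_haar_modulus mu abs.
Local Notation mu2 := (mu \x mu)%E.

Let box n : set (borel K * borel K) := scale_box abs n.

Let abs_ge0 a : 0 <= abs a.
Proof. exact: (modulus_ge0 mu_haar abs_modulus). Qed.

Let ball n : set (borel K) := [set x : K | abs x <= n.+1%:R].

Let mball n : measurable (ball n).
Proof. exact: (closed_ball_measurable mu_haar abs_modulus). Qed.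

Let ball_fin n : (mu (ball n) < +oo)%E.
Proof. exact: (closed_ball_fin mu_haar abs_modulus). Qed.

Lemma scale_box_measurable n : measurable (box n).
Proof.
have mabs := measurable_modulus mu_haar abs_modulus.
pose S : set (borel K) := [set x : K | n.+1%:R^-1 <= abs x].
have mS : measurable S.
  have := mabs measurableT _ (measurable_itv `[n.+1%:R^-1, +oo[).
  by rewrite setTI; congr measurable; apply/funext => x /=; rewrite in_itv /= andbT.
rewrite (_ : box n = (S `&` ball n) `*` ball n); last first.
  by apply/seteqP; split=> z; [move=> [] | move=> [[]]].
by apply: measurableX => //; exact: measurableI.
Qed.

Lemma scale_box_nd : nondecreasing_seq box.
Proof.
move=> m n mn; apply/subsetPset => z [z1 z2 z3].
have mn' : m.+1%:R <= n.+1%:R :> R by rewrite ler_nat.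
split; [|exact: le_trans mn'|exact: le_trans mn'].
by apply: le_trans z1; rewrite lef_pV2// posrE.
Qed.

Lemma scale_box_cover (z : borel K * borel K) : (z.1 : K) != 0 -> exists n, box n z.
Proof.
move=> z0; have a0 := modulus_gt0 mu_haar abs_modulus z0.
(* One integer above the sum bounds each of the three nonnegative terms, hence gives all the box
   conditions. *)
have [n nP] : exists n : nat, (abs z.1)^-1 + abs z.1 + abs z.2 <= n%:R :> R.
  by have := archi_boundP; exists (Num.bound ((abs z.1)^-1 + abs z.1 + abs z.2));
    apply/ltW/archi_boundP; rewrite !addr_ge0// invr_ge0.
have nS : n%:R <= n.+1%:R :> R by rewrite ler_nat.
have i0 : 0 <= (abs z.1)^-1 by rewrite invr_ge0.
have b0 := abs_ge0 z.2.
exists n; split; [|lra|lra].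
by rewrite -[leRHS]invrK lef_pV2 ?posrE ?invr_gt0//; lra.
Qed.

Variable psi : borel K -> R[i].
Hypothesis psi_L2 : L2 mu psi.
Hypothesis mh : cmeasurable
  (fun p : (borel K * borel K) * borel K => scaled_wavelet abs psi p.1 p.2).

Let kern n (z : borel K * borel K) (x : borel K) : R[i] :=
  (\1_(box n) z)%:C * scaled_wavelet abs psi z x.

Let mkern n : cmeasurable (fun p : (borel K * borel K) * borel K => kern n p.1 p.2).
Proof.
apply: cmeasurableM => //; apply: cmeasurable_real.
apply: (measurableT_comp _ measurable_fst).
by apply: measurable_indic; exact: scale_box_measurable.
Qed.

Let kern0 n z x : ~ box n z -> kern n z x = 0.
Proof. by move=> nz; rewrite /kern indicE memNset// mul0r. Qed.

Let normc_kern n a b x : box n (a, b) ->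
  normc (kern n (a, b) x) ^+ 2 =
  (abs a)^-1 ^+ 3 * normc (psi (((x : K) - (b : K)) / (a : K))) ^+ 2.
Proof.
move=> ab; rewrite /kern indicE mem_set// mul1r /scaled_wavelet /wavelet.
rewrite !normcM !normc_real !exprMn !real_normK ?num_real//.
by rewrite !exprVn sqr_sqrtr// mulrA -invfM -exprSr.
Qed.

Let boxV n a b : box n (a, b) -> (abs a)^-1 <= n.+1%:R.
Proof.
move=> [/= a1 _ _]; rewrite -[leRHS]invrK lef_pV2// posrE ?invr_gt0//.
by apply: lt_le_trans a1; rewrite invr_gt0.
Qed.

(** The squared kernel is |a|^-3 |psi((x - b) / a)|^2: two powers from the scaling, one from the
    normalization of the wavelet, and |a|^-1 <= n + 1 on the box. In b the argument is affine with
    ratio -a, so integrating over b costs |a| <= n + 1; a then ranges over a ball of finite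
    measure. *)
Lemma scale_box_sqnorm_fin n x : (sqnorm mu2 (kern n ^~ x) < +oo)%E.
Proof.
have mk : cmeasurable (kern n ^~ x).
  exact: (cmeasurable_comp (pair2_measurable x) (mkern n)).
rewrite sqnorm_tonelli1//.
pose M : \bar R := ((n.+1%:R ^+ 3 * n.+1%:R)%:E * sqnorm mu psi)%E.
have M0 : (0 <= M)%E by rewrite mule_ge0 ?sqnorm_ge0// lee_fin mulr_ge0.
have Moo : (M < +oo)%E.
  by rewrite lte_mul_pinfty// ?lee_fin ?mulr_ge0//; case: psi_L2.
apply: (@le_lt_trans _ _ (\int[mu]_a (M * (\1_(ball n) a)%:E))%E).
  apply: ge0_le_integral => //.
  - by move=> a _; exact: sqnorm_ge0.
  - apply: (measurable_fun_fubini_tonelli_F (fun z => (normc (kern n z x) ^+ 2)%:E)).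
      exact: measurable_sqr_normc.
    by move=> z; rewrite lee_fin sqr_ge0.
  - apply: measurable_funeM; apply/measurable_EFinP.
    exact: measurable_indic.
  - move=> a _.
    have [aB|aB] := pselect (n.+1%:R^-1 <= abs a /\ ball n a); last first.
      rewrite [leLHS](_ : _ = 0%E); last first.
        rewrite /sqnorm (eq_integral (cst 0%E)) ?integral0// => b _.
        rewrite kern0 ?normc0 ?expr0n// => -[/= a1 a2 _]; apply: aB.
        by split.
      by rewrite mule_ge0// lee_fin indicE ler0n.
    have [a1 a2] := aB; rewrite indicE mem_set// mule1.
    have a0 : (a : K) != 0.
      rewrite -(modulus_eq0 mu_haar abs_modulus) gt_eqF//.
      by apply: lt_le_trans a1; rewrite invr_gt0.
    have Na0 : (- a : K) != 0 by rewrite oppr_eq0.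
    apply: (@le_trans _ _ ((n.+1%:R ^+ 3)%:E *
        sqnorm mu (fun b : borel K => psi (((b : K) - (x : K)) / (- (a : K)))%R))%E).
      rewrite -ge0_integralZl//.
      + apply: ge0_le_integral => //.
        * by move=> b _; rewrite lee_fin sqr_ge0.
        * apply: measurable_sqr_normc.
          exact: (cmeasurable_comp (pair1_measurable (a : borel K)) mk).
        * apply: measurable_funeM; apply: measurable_sqr_normc.
          exact: (cmeasurable_affine mu_haar abs_modulus _ _ (L2_meas psi_L2)).
        * move=> b _; rewrite -EFinM lee_fin.
          have [ab|ab] := pselect (box n (a, b)); last first.
            by rewrite kern0// normc0 expr0n/= mulr_ge0 ?sqr_ge0.
          rewrite normc_kern// invrN mulrN -mulNr opprB.
          apply: ler_wpM2r; first exact: sqr_ge0.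
          by apply: lerXn2r; rewrite ?nnegrE ?invr_ge0//; exact: boxV ab.
      + apply: measurable_sqr_normc.
        exact: (cmeasurable_affine mu_haar abs_modulus _ _ (L2_meas psi_L2)).
      + by move=> b _; rewrite lee_fin sqr_ge0.
    rewrite (sqnorm_affine mu_haar abs_modulus x Na0 (L2_meas psi_L2)) muleA -EFinM.
    rewrite (modulusN mu_haar abs_modulus); apply: lee_wpmul2r; first exact: sqnorm_ge0.
    by rewrite lee_fin ler_wpM2l.
rewrite ge0_integralZl//; last by apply/measurable_EFinP; exact: measurable_indic.
rewrite integral_indic// setIT.
apply: lte_mul_pinfty => //; last exact: ball_fin.
by rewrite ge0_fin_numE.
Qed.

(** The norm of a wavelet is that of psi for nonzero a, so on the box the integrand is at most (n +
    1)^2 times the squared norm of psi; the box lies in a product of two balls of finite measure. *)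
Lemma scale_box_integral_fin n : (\int[mu2]_z sqnorm mu (kern n z) < +oo)%E.
Proof.
pose M : \bar R := ((n.+1%:R ^+ 2)%:E * sqnorm mu psi)%E.
have M0 : (0 <= M)%E by rewrite mule_ge0 ?sqnorm_ge0// lee_fin.
have Moo : (M < +oo)%E.
  by rewrite lte_mul_pinfty// ?lee_fin//; case: psi_L2.
have mbox := scale_box_measurable n.
apply: (@le_lt_trans _ _ (\int[mu2]_z (M * (\1_(box n) z)%:E))%E).
  apply: ge0_le_integral => //.
  - by move=> z _; exact: sqnorm_ge0.
  - apply: (measurable_fun_fubini_tonelli_F (fun p => (normc (kern n p.1 p.2) ^+ 2)%:E)).
      exact: measurable_sqr_normc.
    by move=> z; rewrite lee_fin sqr_ge0.
  - by apply: measurable_funeM; apply/measurable_EFinP; exact: measurable_indic.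
  - move=> [a b] _; have [ab|ab] := pselect (box n (a, b)); last first.
      rewrite [leLHS](_ : _ = 0%E); last first.
        rewrite /sqnorm (eq_integral (cst 0%E)) ?integral0// => x _.
        by rewrite kern0// normc0 expr0n.
      by rewrite mule_ge0// lee_fin indicE ler0n.
    have a0 : (a : K) != 0.
      rewrite -(modulus_eq0 mu_haar abs_modulus) gt_eqF//.
      by have [/= a1 _ _] := ab; apply: lt_le_trans a1; rewrite invr_gt0.
    have w2 := L2_wavelet mu_haar abs_modulus a b psi_L2.
    rewrite indicE mem_set// mule1.
    rewrite (@eq_sqnorm _ _ _ _ _ (fun x : borel K => ((abs a)^-1)%:C * wavelet abs psi a b x)).
      rewrite (sqnormZ mu _ (L2_meas w2)).
      rewrite (sqnorm_wavelet mu_haar abs_modulus b a0 (L2_meas psi_L2)).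
      apply: lee_wpmul2r; first exact: sqnorm_ge0.
      rewrite lee_fin normc_real ger0_norm ?invr_ge0//.
      by apply: lerXn2r; rewrite ?nnegrE ?invr_ge0//; exact: boxV ab.
    by move=> x; rewrite /kern indicE mem_set// mul1r.
rewrite ge0_integralZl//; last by apply/measurable_EFinP; exact: measurable_indic.
rewrite integral_indic// setIT.
apply: lte_mul_pinfty => //; first by rewrite ge0_fin_numE.
apply: (@le_lt_trans _ _ (mu2 (ball n `*` ball n))).
  apply: le_measure; rewrite ?inE//; first exact: measurableX.
  by move=> z [].
rewrite product_measure1E//; apply: lte_mul_pinfty => //.
by rewrite ge0_fin_numE//; exact: ball_fin.
Qed.

End ScaleBoxes.

(** * The three forms of the inversion formula *)

Theorem theorem4p2 (R : realType) (K : localFieldType)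
    (mu : {sigma_finite_measure set (borel K) -> \bar R})
    (abs : K -> R) (chi : K -> R[i])
    (mu_haar : is_haar mu)
    (abs_modulus : is_haar_modulus mu abs)
    (chi_basic : basic_character abs chi)
    (mu_inversion : fourier_inversion mu chi)
    (mu_parseval : parseval mu chi)
    (psi psihat f : K -> R[i])
    (psi_L2 : cLp mu 2%:E psi)
    (psihat_fourier : is_fourierL2 mu chi psi psihat)
    (psi_admissible : (admissibility_constant mu abs psihat < +oo)%E)
    (psi_nontrivial : admissibility_constant mu abs psihat <> 0%E)
    (f_L2 : cLp mu 2%:E f) :
  let c : R[i] := (fine (admissibility_constant mu abs psihat))%:C in
  let mu2 := (mu \x mu)%E in
  [/\ (* weakly in L^2 *)
      forall g : K -> R[i], cLp mu 2%:E g ->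
        cintegrable mu2 setT (weak_reconstruction_integrand mu abs psi f g) /\
        cdot mu f g =
          c^-1 * cintegral mu2 setT
                   (weak_reconstruction_integrand mu abs psi f g),
      (* in the norm of L^2, as an improper integral *)
      (forall n (x : K), cintegrable mu2 (scale_box abs n)
         (reconstruction_integrand mu abs psi f x)) /\
      (fun n => cLnorm mu 2%:E (fun x : borel K =>
         c^-1 * cintegral mu2 (scale_box abs n)
                  (reconstruction_integrand mu abs psi f x) - f x))
        @ \oo --> 0%E
    & (* almost everywhere where the double integral converges absolutely *)
      {ae mu, forall x : borel K,
         cintegrable mu2 setT (reconstruction_integrand mu abs psi f x) ->
         f x = c^-1 * cintegral mu2 setT
                        (reconstruction_integrand mu abs psi f x)}].
Proof.
move=> c mu2.
have [chi_char _ _] := chi_basic.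
have {}psi_L2 : L2 mu psi by exact/cLp2P.
have {}f_L2 : L2 mu f by exact/cLp2P.
have C0 := admissibility_constant_ge0 mu_haar abs_modulus psihat.
(* [fine] sends +oo to 0, so positivity uses admissibility as well as nontriviality. *)
have c0 : 0 < fine (admissibility_constant mu abs psihat).
  by rewrite fine_gt0// psi_admissible andbT lt0e C0 andbT; exact/eqP.
have mh := cmeasurable_scaled_wavelet mu_haar abs_modulus psihat_fourier.
have hL2 := L2_scaled_wavelet mu_haar abs_modulus psihat_fourier.
(* The measure [mu2] again, now with the sigma-finite structure that the resolution lemmas ask
   for. *)
pose nu := sigma_finite_product mu mu.
have iso : forall f, L2 mu f -> sqnorm nu (analysis mu (scaled_wavelet abs psi) f) =
    ((fine (admissibility_constant mu abs psihat))%:E * sqnorm mu f)%E.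
  move=> g g2; exact: (sqnorm_analysis mu_haar abs_modulus chi_char mu_parseval
    psihat_fourier psi_admissible g2).
have mE := scale_box_measurable mu_haar abs_modulus.
have ndE := scale_box_nd abs.
(* A parameter missed by all boxes has a = 0, where the scaled wavelet is 0 because 0^-1 = 0. *)
have cover z : (exists n, scale_box abs n z) \/
    (forall x, scaled_wavelet abs psi z x = 0).
  have [z0|z0] := eqVneq (z.1 : K) 0; last by left; exact: (scale_box_cover mu_haar abs_modulus).
  by right=> x; rewrite /scaled_wavelet z0 (modulus0 abs_modulus) invr0 mul0r.
have hE := scale_box_sqnorm_fin mu_haar abs_modulus psi_L2 mh.
have hE2 := scale_box_integral_fin mu_haar abs_modulus psi_L2 mh.
have reconE x : reconstruction_integrand mu abs psi f x =
    (fun z => analysis mu (scaled_wavelet abs psi) f z * scaled_wavelet abs psi z x).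
  apply/funext => z; rewrite (analysisE mu_haar abs_modulus psihat_fourier)//.
  rewrite /reconstruction_integrand /scaled_wavelet -exprVn expr2 rmorphM /=; ring.
have synthesisE n x : cintegral mu2 (scale_box abs n)
      (reconstruction_integrand mu abs psi f x) =
    synthesis mu nu (scaled_wavelet abs psi) (scale_box abs) f n x.
  by rewrite cintegral_mkcond reconE.
split.
- move=> g /cLp2P g_L2.
  have weakE : weak_reconstruction_integrand mu abs psi f g =
      (fun z => analysis mu (scaled_wavelet abs psi) f z *
                (analysis mu (scaled_wavelet abs psi) g z)^*).
    apply/funext => z; rewrite !(analysisE mu_haar abs_modulus psihat_fourier)//.
    rewrite /weak_reconstruction_integrand /wavelet_transform.
    rewrite (cdot_conj g_L2 (L2_wavelet mu_haar abs_modulus z.1 z.2 psi_L2)).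
    by rewrite cconjM cconj_real -exprVn expr2 rmorphM /=; ring.
  have f_G := L2_analysis (nu := nu) mh c0 iso f_L2.
  have g_G := L2_analysis (nu := nu) mh c0 iso g_L2.
  rewrite weakE; split; first exact: (L2_cdot_cintegrable f_G g_G).
  have := cdot_analysis (nu := nu) mh hL2 c0 iso f_L2 g_L2; rewrite {1}/cdot => ->.
  by rewrite mulrA real_complexVK ?mul1r.
- split.
    move=> n x; apply/cintegrable_mkcond; first exact: mE.
    rewrite reconE; exact: (synthesis_cintegrable (nu := nu) mh c0 iso mE hE f_L2).
  under eq_fun do under eq_fun do rewrite synthesisE.
  apply/cLnorm2_cvg0 => e e0.
  exact: (synthesis_cvg (nu := nu) mh hL2 c0 iso mE ndE cover hE hE2 f_L2 e0).
- have := synthesis_ae (nu := nu) mh hL2 c0 iso mE ndE cover hE hE2 f_L2.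
  by apply: filterS => x h; rewrite reconE; exact: h.
Qed.
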